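(* Fix $\eta\in(0,1/2)$. There exists an $O(n^5)$-time TSP-domination algorithm which has domination ratio at least $1-O(\exp(-\eta^4 n/10^4))$ for every $\{0,1\}$-instance $(n,w)$ of TSP satisfying $w(K_n)=d\binom{n}{2}$ for some $d\in[\eta,1-\eta]$.
   Context: $K_n=(V_n,E_n)$ denotes the complete graph on $n$ vertices and $\mathcal{H}_n$ the set of its (undirected) Hamilton cycles. An instance $(n,w)$ of TSP consists of a positive integer $n$ and an edge weighting $w:E_n\to\mathbb{R}$; for a subgraph $G$ of $K_n$, $w(G)=\sum_{e\in E(G)}w(e)$. A $\{0,1\}$-instance is one with $w:E_n\to\{0,1\}$. A TSP-domination algorithm, given an instance $(n,w)$, outputs a Hamilton cycle $H^*$ of $K_n$; it has domination ratio at least $r$ for $(n,w)$ if $\mathbb{P}(w(H)<w(H^* ))\le 1-r$ for $H$ uniformly random in $\mathcal{H}_n$. *)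

(* Defs.v *)
From Stdlib Require Import Reals.
From mathcomp Require Import all_boot all_fingroup.

Set Implicit Arguments.
Unset Strict Implicit.
Unset Printing Implicit Defensive.

(* An edge weighting is w : {set 'I_n} -> nat (only its values on      *)
(* 2-element sets are ever used).                                      *)

Definition Kn_edges (n : nat) : {set {set 'I_n}} := [set e : {set 'I_n} | #|e| == 2].

Definition wt (n : nat) (w : {set 'I_n} -> nat) (E : {set {set 'I_n}}) : nat :=
  \sum_(e in E) w e.

Definition zero_one (n : nat) (w : {set 'I_n} -> nat) : Prop :=
  forall e : {set 'I_n}, #|e| = 2 -> w e <= 1.

Definition cyc_edges (n : nat) (p : {perm 'I_n}) : {set {set 'I_n}} :=
  [set [set p i; p (ordS i)] | i : 'I_n].

Definition ham_cycles (n : nat) : {set {set {set 'I_n}}} :=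
  [set cyc_edges p | p : {perm 'I_n}].

Definition dom_ratio_at_least (n : nat) (w : {set 'I_n} -> nat)
    (Hstar : {set {set 'I_n}}) (r : R) : Prop :=
  Rle (Rdiv (INR #|[set H in ham_cycles n | (wt w H < wt w Hstar)%N]|)
            (INR #|ham_cycles n|))
      (Rminus 1 r).

(* Model of computation: a unit-cost random access machine.           *)

Inductive instr : Type :=
| IConst of nat & nat
| IAdd of nat & nat & nat
| ISub of nat & nat & nat
| ILoad of nat & nat
| IStore of nat & nat
| IJz of nat & nat.

Record mstate : Type := MState { pc : nat; mem : nat -> nat }.

Definition upd (m : nat -> nat) (a v : nat) : nat -> nat :=
  fun x => if x == a then v else m x.

Definition step (prog : seq instr) (s : mstate) : mstate :=
  let m := mem s in
  let k := pc s in
  match nth (IJz 0 0) prog k with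
  | IConst a c => MState k.+1 (upd m a c)
  | IAdd a b c => MState k.+1 (upd m a (m b + m c))
  | ISub a b c => MState k.+1 (upd m a (m b - m c))
  | ILoad a b => MState k.+1 (upd m a (m (m b)))
  | IStore a b => MState k.+1 (upd m (m a) (m b))
  | IJz a t => MState (if m a == 0 then t else k.+1) m
  end.

Fixpoint exec (prog : seq instr) (fuel : nat) (s : mstate) : option (nat -> nat) :=
  if size prog <= pc s then Some (mem s)
  else match fuel with
       | 0 => None
       | f.+1 => exec prog f (step prog s)
       end.

(* Input encoding of an instance (n,w): M[0] = n and
   M[1 + i*n + j] = w({i,j}) for distinct i,j < n; all other cells 0. *)
Definition enc_weight (n : nat) (w : {set 'I_n} -> nat) (i j : nat) : nat :=
  match (insub i : option 'I_n), (insub j : option 'I_n) with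
  | Some i', Some j' => if i' == j' then 0 else w [set i'; j']
  | _, _ => 0
  end.

Definition init_state (n : nat) (w : {set 'I_n} -> nat) : mstate :=
  MState 0 (fun x => if x == 0 then n
                     else if x - 1 < n * n then enc_weight w ((x - 1) %/ n) ((x - 1) %% n)
                     else 0).

(* Output convention: cells M[0], ..., M[n-1] list the vertices of the
   Hamilton cycle in cyclic order. *)
Definition valid_output (n : nat) (m : nat -> nat) : Prop :=
  perm_eq [seq m i | i <- iota 0 n] (iota 0 n).

Definition output_cycle (n : nat) (m : nat -> nat) : {set {set 'I_n}} :=
  [set [set x : 'I_n | (val x == m (val i)) || (val x == m ((val i).+1 %% n))]
     | i : 'I_n].

(* Main.v *)
(* Vertices sit at positions 0, ..., n-1 and the Hamilton cycle visits the
   positions in the zigzag order 0, n-1, 1, n-2, ..., so that its edges join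
   positions of sum n-1 (the "matching") or n (the "rest"), up to one closing
   edge.  The algorithm is a local search for the potential
   (weight of the rest) + 5 (weight of the matching); a move exchanges two pairs
   of positions and may re-match three matching edges {a,a'}, {b,b'}, {c,c'} as
   {a,c}, {b,c'}, {a',b'}.  The potential is at most 3n (6n in Phi, which counts every
   edge twice), so 8n passes over all O(n^3) moves, each evaluated in time O(n), end
   in a local optimum.

   At a local optimum, exchanging two whole matching edges shows by averaging
   that the rest weighs at most dn/2 + O(1).  Let U be the set of ends of matching
   edges of weight 1: the moves force weight 1 on all edges inside U, forbid two
   disjoint weight-0 edges from a matching edge of weight 0 to U, and forbid short
   augmenting paths through two such edges.  Double counting then gives a matching
   of weight at most dn/2 - (2/25) eta^2 n + O(1).

   A transposition changes the weight of a cycle by at most 4, so exposing a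
   uniform permutation one value at a time gives
   E exp(-l (w(H) - dn)) <= exp(16 l^2 n), and l = eta^2/400 yields the bound. *)
Require Import Defs.
From HB Require Import structures.
From Stdlib Require Import Reals Lra FunctionalExtensionality.
From mathcomp Require Import all_boot all_fingroup zify_ssreflect.

Set Implicit Arguments.
Unset Strict Implicit.
Unset Printing Implicit Defensive.

(** * Verified code fragments for the random access machine *)

(** A random Hamilton cycle has mean weight [d n], and averaging alone gets no lower. An
    exponentially small set of better cycles needs a cycle below the mean by a multiple of
    [eta^2 n]. The whole gain comes from the matching; the rest only has to stay near its average.
    The factor on the matching is just large enough that no change of the rest outweighs the
    improvement of a single matching edge, so a local optimum of the sum is locally optimal for the
    matching alone.

    No minimum matching is computed: the counting uses only exchanges of two or three edges, and
    three nested loops enumerate these. If the matching weighed almost [d n / 2], then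
    [d <= 1 - eta] would leave about [eta n] positions on matching edges of weight 0. The conditions
    at these edges force extra weight of order at least [eta^2 n^2] in the graph, more than its
    total allows. *)

Notation mem_t := (nat -> nat).

Definition straight (i : instr) : bool := if i is IJz _ _ then false else true.

Definition run_instr (m : mem_t) (i : instr) : mem_t :=
  match i with
  | IConst a c => upd m a c
  | IAdd a b c => upd m a (m b + m c)
  | ISub a b c => upd m a (m b - m c)
  | ILoad a b => upd m a (m (m b))
  | IStore a b => upd m (m a) (m b)
  | IJz _ _ => m
  end.

Definition run_code (l : seq instr) (m : mem_t) : mem_t := foldl run_instr m l.

Inductive reach (prog : seq instr) : nat -> mstate -> mstate -> Prop :=
| reach0 s : reach prog 0 s s
| reachS t s s' : pc s < size prog -> reach prog t (step prog s) s' ->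
    reach prog t.+1 s s'.

Lemma reach_trans prog t1 t2 s1 s2 s3 :
  reach prog t1 s1 s2 -> reach prog t2 s2 s3 -> reach prog (t1 + t2) s1 s3.
Proof. by elim=> //= t s s' lt_s _ IH /IH; rewrite addSn; apply: reachS. Qed.

Lemma reach_exec prog t f s s' :
  reach prog t s s' -> exec prog (t + f) s = exec prog f s'.
Proof.
elim=> //= u s1 s2 lt_s _ <-.
by rewrite leqNgt lt_s.
Qed.

Lemma exec_halt prog t f s m :
  reach prog t s (MState (size prog) m) -> t <= f -> exec prog f s = Some m.
Proof.
move=> r le_tf; rewrite -(subnKC le_tf) (reach_exec _ r).
by case: (f - t) => [|k] /=; rewrite leqnn.
Qed.

(* Code depends on the address at which it is placed, because jump targets are
   absolute. *)
Definition frag := nat -> seq instr.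

(** Quantifying over the surrounding code makes a triple independent of its placement, so fragments
    compose without relocation. Exhibiting one run suffices because [step] is a function; halting
    within [T] steps is part of the claim. *)
Definition wp (F : frag) (m : mem_t) (Q : mem_t -> Prop) (T : nat) : Prop :=
  forall pre post : seq instr, exists m' t,
    [/\ t <= T, Q m' & reach (pre ++ F (size pre) ++ post) t
      (MState (size pre) m) (MState (size pre + size (F (size pre))) m')].

Definition Code (l : seq instr) : frag := fun=> l.

Definition Seq (F G : frag) : frag := fun k => F k ++ G (k + size (F k)).

(* Cell 1 (below: cell z) is overwritten by unconditional jumps. *)
Definition While (r : nat) (F : frag) : frag := fun k =>
  let b := F k.+1 in
  IJz r (k + size b + 3) :: b ++ [:: IConst 1 0; IJz 1 k].

Definition If (z r : nat) (F G : frag) : frag := fun k =>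
  let b := F k.+1 in
  let e := k + size b + 3 in
  let c := G e in
  IJz r e :: b ++ [:: IConst z 0; IJz z (e + size c)] ++ c.

Lemma wp_weaken F m (Q Q' : mem_t -> Prop) T T' :
  wp F m Q T -> T <= T' -> (forall m', Q m' -> Q' m') -> wp F m Q' T'.
Proof.
move=> h le_T QQ' pre post; have [m' [t [le_t Qm' r]]] := h pre post.
by exists m', t; split; [exact: leq_trans le_T | exact: QQ' |].
Qed.

Lemma reach_straight l pre post m : all straight l ->
  reach (pre ++ l ++ post) (size l) (MState (size pre) m)
    (MState (size pre + size l) (run_code l m)).
Proof.
elim: l pre m => [|i l IH] pre m /=; first by rewrite addn0; constructor.
case/andP=> si sl; constructor; first by rewrite /= !size_cat /=; lia.
have -> : pre ++ (i :: l) ++ post = rcons pre i ++ l ++ post.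
  by rewrite cat_rcons.
have -> : step (rcons pre i ++ l ++ post) (MState (size pre) m)
  = MState (size (rcons pre i)) (run_instr m i).
  rewrite /step /= cat_rcons nth_cat ltnn subnn /= size_rcons.
  by case: i si.
have -> : size pre + (size l).+1 = size (rcons pre i) + size l.
  by rewrite size_rcons addnS addSn.
exact: IH.
Qed.

Lemma wp_code l m (Q : mem_t -> Prop) T :
  all straight l -> size l <= T -> Q (run_code l m) -> wp (Code l) m Q T.
Proof.
move=> sl le_T Qm pre post; exists (run_code l m), (size l); split=> //.
exact: reach_straight.
Qed.

Lemma wp_seq F G m (Q : mem_t -> Prop) T1 T2 :
  wp F m (fun m' => wp G m' Q T2) T1 -> wp (Seq F G) m Q (T1 + T2).
Proof.
move=> hF pre post; rewrite /Seq; set b := F _; set c := G _.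
have [m1 [t1 [le1 hG r1]]] := hF pre (c ++ post).
have [m2 [t2 [le2 Qm r2]]] := hG (pre ++ b) post.
exists m2, (t1 + t2); split=> //; first exact: leq_add.
move: r2; rewrite size_cat -/c -!catA => r2.
rewrite size_cat addnA; apply: reach_trans r2.
exact: r1.
Qed.

Lemma reach_jz prog r k k' m :
  nth (IJz 0 0) prog k = IJz r k' -> k < size prog ->
  reach prog 1 (MState k m) (MState (if m r == 0 then k' else k.+1) m).
Proof.
move=> e lt_k; apply: reachS => //.
rewrite /step /= e; exact: reach0.
Qed.

Lemma reach_jump z pre post k m :
  reach (pre ++ [:: IConst z 0; IJz z k] ++ post) 2 (MState (size pre) m)
    (MState k (upd m z 0)).
Proof.
rewrite -[2]/(1 + 1); apply: (@reach_trans _ _ _ _ (MState (size pre).+1 (upd m z 0))).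
  have := @reach_straight [:: IConst z 0] pre (IJz z k :: post) m isT.
  by rewrite /= addn1.
have := @reach_jz (pre ++ [:: IConst z 0; IJz z k] ++ post) z (size pre).+1 k (upd m z 0).
rewrite {2}/upd eqxx /=; apply; last by rewrite size_cat /=; lia.
by rewrite nth_cat ltnNge leqnSn /= subSnn.
Qed.

Lemma wp_if z r F G m (Q Q' : mem_t -> Prop) T :
  (m r <> 0 -> wp F m Q' T) -> (forall m', Q' m' -> Q (upd m' z 0)) ->
  (m r = 0 -> wp G m Q T) -> wp (If z r F G) m Q (T + 3).
Proof.
move=> hF QQ' hG pre post; rewrite /If.
set b := F _; set e := size pre + size b + 3; set c := G e.
set prog := _ ++ _.
have jz : reach prog 1 (MState (size pre) m)
    (MState (if m r == 0 then e else (size pre).+1) m).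
  apply: reach_jz; last by rewrite /prog size_cat /=; lia.
  by rewrite /prog nth_cat ltnn subnn.
have es : size pre + size (IJz r e :: b ++ [:: IConst z 0; IJz z (e + size c)] ++ c)
   = e + size c by rewrite /= !size_cat /= /e; lia.
rewrite es; have [m0|/eqP m0] := boolP (m r == 0).
  have [m' [t [le_t Qm' rG]]] := hG (eqP m0) (pre ++ IJz r e :: b ++ [:: IConst z 0; IJz z (e + size c)]) post.
  exists m', (1 + t); split=> //; first lia.
  apply: reach_trans jz _; rewrite m0.
  move: rG; rewrite size_cat /= size_cat /=.
  have -> : size pre + (size b + 2).+1 = e by rewrite /e; lia.
  by rewrite -/c /prog -!catA /= -!catA /=.
have [m' [t [le_t Qm' rF]]] := hF m0 (rcons pre (IJz r e)) ([:: IConst z 0; IJz z (e + size c)] ++ c ++ post).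
exists (upd m' z 0), (1 + (t + 2)); split; [lia | exact: QQ' |].
apply: reach_trans jz _; rewrite (negPf (introN eqP m0)).
move: rF; rewrite size_rcons -/b => rF.
apply: (@reach_trans _ _ _ _ (MState ((size pre).+1 + size b) m')).
  by move: rF; rewrite cat_rcons /prog /= -!catA.
have := @reach_jump z (pre ++ IJz r e :: b) (c ++ post) (e + size c) m'.
rewrite size_cat /= addnS addSn.
by rewrite /prog -!catA /= -!catA /=.
Qed.

(** The functional meaning of a [While] whose counter falls by one per round: [f] sees the counter
    values [k, ..., 1]. *)
Fixpoint countdown (S : Type) (f : nat -> S -> S) (k : nat) (s : S) : S :=
  if k is k'.+1 then countdown f k' (f k s) else s.

(** The body decrements [r] itself. Loop control adds three instructions per round and one for the
    final test; the jump back clears cell 1, hence the closure condition on [I]. *)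
Lemma wp_while (S : Type) (f : nat -> S -> S) (I : S -> mem_t -> Prop) r F T k s m :
  r != 1 -> (forall s m, I s m -> I s (upd m 1 0)) ->
  (forall j s m, j < k -> I s m -> m r = j.+1 ->
     wp F m (fun m' => I (f j.+1 s) m' /\ m' r = j) T) ->
  I s m -> m r = k ->
  wp (While r F) m (fun m' => I (countdown f k s) m' /\ m' r = 0) (k * (T + 3) + 1).
Proof.
move=> r1 I1; elim: k s m => [|k IH] s m hF Im mr pre post; rewrite /While;
  set b := F _; set prog := _ ++ _.
- exists m, 1; split=> //.
  have -> : size pre + size (IJz r (size pre + size b + 3) :: b ++ [:: IConst 1 0; IJz 1 (size pre)])
    = size pre + size b + 3 by rewrite /= size_cat /=; lia.
  have := @reach_jz prog r (size pre) (size pre + size b + 3) m.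
  rewrite mr /=; apply; last by rewrite /prog size_cat /=; lia.
  by rewrite /prog nth_cat ltnn subnn.
have hk : k < k.+1 by [].
have [m1 [t1 [le1 [I1m m1r] r1m]]] := hF k s m hk Im mr
  (rcons pre (IJz r (size pre + size b + 3)))
  ([:: IConst 1 0; IJz 1 (size pre)] ++ post).
have um1r : upd m1 1 0 r = k by rewrite /upd (negPf r1).
have hF' j s' m' : j < k -> I s' m' -> m' r = j.+1 ->
     wp F m' (fun m' => I (f j.+1 s') m' /\ m' r = j) T.
  by move=> lt_jk; apply: hF; apply: ltn_trans lt_jk _.
have [m2 [t2 [le2 Q2 r2]]] := IH _ _ hF' (I1 _ _ I1m) um1r pre post.
exists m2, (1 + (t1 + (2 + t2))); split=> //; first nia.
apply: (@reach_trans _ _ _ _ (MState (size pre).+1 m)).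
  have := @reach_jz prog r (size pre) (size pre + size b + 3) m.
  rewrite mr /=; apply; last by rewrite /prog size_cat /=; lia.
  by rewrite /prog nth_cat ltnn subnn.
apply: (@reach_trans _ _ _ _ (MState ((size pre).+1 + size b) m1)).
  by move: r1m; rewrite size_rcons cat_rcons -/b /prog /= -!catA.
apply: (@reach_trans _ _ _ _ (MState (size pre) (upd m1 1 0))); last exact: r2.
have -> : prog = (pre ++ IJz r (size pre + size b + 3) :: b) ++
    [:: IConst 1 0; IJz 1 (size pre)] ++ post.
  by rewrite /prog -!catA /= -?catA.
have -> : (size pre).+1 + size b = size (pre ++ IJz r (size pre + size b + 3) :: b).
  by rewrite size_cat /= addnS.
exact: reach_jump.
Qed.

Definition target (i : instr) : option nat :=
  match i with
  | IConst a _ | IAdd a _ _ | ISub a _ _ | ILoad a _ => Some a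
  | _ => None
  end.

Lemma run_frame l m y :
  all (fun i => if target i is Some a then a != y else false) l ->
  run_code l m y = m y.
Proof.
elim: l m => //= i l IH m /andP[hi /IH ->].
by case: i hi => //= [a c|a b c|a b c|a b]; rewrite /upd eq_sym => /negPf->.
Qed.

Lemma run_heap K l m y :
  all (fun i => if target i is Some a then a < K else false) l -> K <= y ->
  run_code l m y = m y.
Proof.
move=> hl le_K; apply: run_frame; apply: sub_all hl => i.
by case: (target i) => // a; lia.
Qed.

(** * The local search program *)

Definition swap_at (P : mem_t) (x y : nat) : mem_t :=
  fun z => if z == y then P x else if z == x then P y else P z.

(** One family of moves serves three purposes. For distinct matching edges it is the three-edge
    exchange; for [b = a] it re-matches two edges as {a, c'}, {a', c}; for [b = n.-1 - a] it swaps
    two whole matching edges and leaves the matching as it is. *)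
Definition rematch (n a b c : nat) (P : mem_t) : mem_t :=
  swap_at (swap_at P (n.-1 - a) c) (n.-1 - b) (n.-1 - c).

Definition term (W : nat -> nat -> nat) (n : nat) (P : mem_t) (x : nat) : nat :=
  W (P x) (P (n - x)) + 5 * W (P x) (P (n.-1 - x)).

(** Starting at [x = 1] keeps vertex 0 from serving as a row index of [W]. In return the matching
    edge at positions [0] and [n.-1] is counted once, all other edges twice. *)
Definition Phi (W : nat -> nat -> nat) (n : nat) (P : mem_t) : nat :=
  \sum_(1 <= x < n) term W n P x.

Definition try (W : nat -> nat -> nat) (n a b c : nat) (P : mem_t) : mem_t :=
  if Phi W n (rematch n a b c P) < Phi W n P then rematch n a b c P else P.

Definition pass (W : nat -> nat -> nat) (n : nat) : mem_t -> mem_t :=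
  countdown (fun a => countdown (fun b => countdown (fun c => try W n a b c) n.-2) n.-2) n.-2.

Definition zig (n i : nat) : nat := if odd i then n.-1 - i./2 else i./2.

Definition goodP (n : nat) (P : mem_t) : Prop :=
  [/\ P 0 = 0, forall x, x < n -> P x < n &
      forall x y, x < n -> y < n -> P x = P y -> x = y].

Lemma swp_swp P x y : swap_at (swap_at P x y) x y = P.
Proof.
apply: functional_extensionality => z; rewrite /swap_at !eqxx.
case: (z =P y) => [->|zy]; first by case: (x =P y) => [->|].
by case: (z =P x) => [->|].
Qed.

Lemma goodP_swp n P x y : goodP n P -> 0 < x < n -> 0 < y < n -> goodP n (swap_at P x y).
Proof.
move=> [P0 Pn Pi] hx hy; split; rewrite /swap_at.
- by rewrite !ifN //; lia.
- by move=> z hz; case: ifP => _; [apply: Pn; lia | case: ifP => _; apply: Pn; lia].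
move=> z t hz ht; case: (z =P y) => [->|zy]; case: (t =P y) => [->|ty] //;
  (try case: (z =P x) => [->|zx]); (try case: (t =P x) => [->|tx]) => // e;
  have := Pi _ _ _ _ e; lia.
Qed.

Lemma goodP_mv n a b c P : goodP n P -> 0 < a < n.-1 -> 0 < b < n.-1 -> 0 < c < n.-1 ->
  goodP n (rematch n a b c P).
Proof. by move=> gP ha hb hc; do 2?apply: goodP_swp => //; lia. Qed.

Lemma goodP_try W n a b c P : goodP n P ->
  0 < a < n.-1 -> 0 < b < n.-1 -> 0 < c < n.-1 -> goodP n (try W n a b c P).
Proof. by move=> gP ha hb hc; rewrite /try; case: ifP => // _; apply: goodP_mv. Qed.

Lemma countdown_ind S (f : nat -> S -> S) (I : S -> Prop) k s :
  (forall j s, 0 < j <= k -> I s -> I (f j s)) -> I s -> I (countdown f k s).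
Proof.
elim: k s => //= k IH s hf Is; apply: IH => [j t hj|]; apply: hf => //; lia.
Qed.

Lemma goodP_pass W n P : goodP n P -> goodP n (pass W n P).
Proof.
move=> gP; apply: countdown_ind gP => a Q ha gQ; apply: countdown_ind gQ => b Q' hb gQ'.
by apply: countdown_ind gQ' => c Q'' hc gQ''; apply: goodP_try => //; lia.
Qed.

Lemma upd_upd m a v v' : upd (upd m a v) a v' = upd m a v'.
Proof. by apply: functional_extensionality => x; rewrite /upd; case: eqP. Qed.

Lemma upd_ne m a v x : x <> a -> upd m a v x = m x.
Proof. by rewrite /upd => /eqP/negPf->. Qed.

Lemma run_cons i l m : run_code (i :: l) m = run_code l (run_instr m i).
Proof. by []. Qed.

Lemma run_cat l1 l2 m : run_code (l1 ++ l2) m = run_code l2 (run_code l1 m).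
Proof. exact: foldl_cat. Qed.

(** The side condition says that the addressed cell is not the scratch cell [t], which the first
    instruction overwrites with the address. *)
Lemma run_load t b i l m : m b + m i <> t ->
  run_code (IAdd t b i :: ILoad t t :: l) m = run_code l (upd m t (m (m b + m i))).
Proof.
move=> ne; rewrite -[LHS]/(run_code l (upd (upd m t (m b + m i)) t
  (upd m t (m b + m i) (upd m t (m b + m i) t)))).
have -> : upd m t (m b + m i) t = m b + m i by rewrite /upd eqxx.
by rewrite upd_upd upd_ne.
Qed.

(* Registers: 0 = n; 2, 3, 4 = a, b, c; 5 = inner counter; 6 = passes left;
   7 = address of the table v |-> v n + 1 of row addresses; 8 = address of the
   position array P; 9 = potential of P; 10 = potential under evaluation;
   11 = n - 1; 12 = 1; 13-16, 19-22 = scratch.  They overwrite weights of row 0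
   only, and row 0 is never read because vertex 0 keeps position 0. *)
Definition swap_code (i j : nat) : seq instr :=
  [:: IAdd 13 8 i; IAdd 14 8 j; ILoad 15 13; ILoad 16 14; IStore 13 16; IStore 14 15].

(** The machine cannot multiply: the row address of [P x] is read from a table, and the factor 5 is
    five additions. *)
Definition eval_body : seq instr :=
  [:: IAdd 13 8 5; ILoad 13 13; IAdd 14 7 13; ILoad 14 14; ISub 15 0 5;
      IAdd 16 8 15; ILoad 16 16; IAdd 16 14 16; ILoad 16 16; IAdd 10 10 16;
      ISub 15 15 12;
      IAdd 16 8 15; ILoad 16 16; IAdd 16 14 16; ILoad 16 16;
      IAdd 10 10 16; IAdd 10 10 16; IAdd 10 10 16; IAdd 10 10 16; IAdd 10 10 16;
      ISub 5 5 12].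

Definition eval_code : frag :=
  Seq (Code [:: IConst 10 0; ISub 5 0 12]) (While 5 (Code eval_body)).

(** Truncated subtraction makes register 13 nonzero exactly when the move lowers the potential.
    Otherwise the same two transpositions, in reverse order, restore the arrangement. *)
Definition try_code : frag :=
  Seq (Code ([:: ISub 20 11 2; ISub 21 11 3; ISub 22 11 4]
             ++ swap_code 20 4 ++ swap_code 21 22))
  (Seq eval_code
  (Seq (Code [:: ISub 13 9 10])
  (Seq (If 1 13 (Code [:: IConst 13 0; IAdd 9 10 13])
              (Code (swap_code 21 22 ++ swap_code 20 4)))
       (Code [:: ISub 4 4 12])))).

Definition loop_code (r : nat) (F : frag) : frag :=
  Seq (Code [:: ISub r 11 12]) (While r F).

Definition down_code (r : nat) : frag := Code [:: ISub r r 12].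

Definition pass_code : frag :=
  Seq (loop_code 2 (Seq (loop_code 3 (Seq (loop_code 4 try_code)
    (down_code 3))) (down_code 2))) (down_code 6).

Definition fill_body : seq instr :=
  [:: IAdd 15 7 13; IStore 15 14; IAdd 15 8 13; IStore 15 13;
      IAdd 14 14 0; IAdd 13 13 12; ISub 5 5 12].

(** [n * n + 1] arises from [n] additions. Two tables of length [n] follow the weights: the row
    addresses and the identity arrangement. Three doublings of [n] give the [8 n] passes. *)
Definition init_code : frag :=
  Seq (Code [:: IConst 12 1; ISub 11 0 12; IConst 7 1; IConst 13 0; IAdd 5 0 13])
  (Seq (While 5 (Code [:: IAdd 7 7 0; ISub 5 5 12]))
  (Seq (Code [:: IAdd 8 7 0; IAdd 5 0 13; IConst 14 1])
  (Seq (While 5 (Code fill_body))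
  (Seq eval_code
       (Code [:: IConst 13 0; IAdd 9 10 13; IAdd 6 0 0; IAdd 6 6 6; IAdd 6 6 6]))))).

(** A round writes entries [2 i] and [2 i + 1] of the zigzag listing. Letting [i] run over all
    values below [n] fills [2 n] cells and avoids halving [n]; the first [n] of them form the
    cycle. *)
Definition zig_body : seq instr :=
  [:: ISub 13 5 12; IAdd 14 8 13; ILoad 14 14; ISub 15 0 5;
      IAdd 15 8 15; ILoad 15 15; IAdd 16 19 13; IAdd 16 16 13; IStore 16 14;
      IAdd 16 16 12; IStore 16 15; ISub 5 5 12].

Definition copy_body : seq instr :=
  [:: IAdd 14 13 5; IAdd 15 19 14; ILoad 15 15; IStore 14 15; ISub 5 5 12].

(** Each cell [a] is its own scratch register, so only the base address in cell 0 has to survive. *)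
Definition low_code (l : seq nat) : seq instr :=
  flatten [seq [:: IConst a a; IAdd a a 0; ILoad a a] | a <- l].

(** The output has to occupy the cells of the registers. Hence the listing is built behind the other
    arrays, the cells from 24 on are copied by a loop, and the low cells are filled by straight-line
    code, cell 0 with the base address last of all. *)
Definition finish_code : frag :=
  Seq (Code [:: IAdd 19 8 0; IConst 13 0; IAdd 5 0 13])
  (Seq (While 5 (Code zig_body))
  (Seq (Code [:: IConst 13 0; IAdd 5 0 13; IConst 13 23])
  (Seq (While 5 (Code copy_body))
       (Code ([:: IConst 1 0; IAdd 0 19 1] ++ low_code (iota 1 23) ++ [:: ILoad 0 0]))))).

Definition main_code : frag :=
  Seq init_code (Seq (While 6 pass_code) finish_code).

(* Below 24 vertices the registers would overlap the weights that are read. *)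
Definition tsp_code : frag :=
  Seq (Code [:: IConst 1 24; ISub 1 1 0])
      (If 24 1 (Code [seq IConst i i | i <- rev (iota 0 24)]) main_code).

(** * Memory invariant; evaluating the potential and trying one move *)

Section Evaluation.

Variables (n : nat) (W : nat -> nat -> nat).
Hypothesis n24 : 24 <= n.

Local Notation RB := (n * n + 1).
Local Notation PB := (n * n + n + 1).

Definition Inv (P m : mem_t) : Prop :=
  [/\ m 0 = n, m 7 = RB, m 8 = PB, m 11 = n.-1 & m 12 = 1] /\
  [/\ forall v, v < n -> m (RB + v) = v * n + 1,
      forall x, x < n -> m (PB + x) = P x &
      forall u v, 0 < u < n -> v < n -> m (u * n + v + 1) = W u v].

(** Row [u > 0] starts at cell [n + 1 >= 25], so these weights lie above all registers and below the
    tables. *)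
Lemma weight_cell u v : 0 < u < n -> v < n -> 24 <= u * n + v + 1 < RB.
Proof. by nia. Qed.

Lemma Inv_ext P P' m m' : Inv P m ->
  (forall r, r \in [:: 0; 7; 8; 11; 12] -> m' r = m r) ->
  (forall y, 24 <= y < PB -> m' y = m y) ->
  (forall x, x < n -> m' (PB + x) = P' x) -> Inv P' m'.
Proof.
move=> [[m0 m7 m8 m11 m12] [mR mP mW]] hr hy hP.
split; first by rewrite !hr.
split=> // [v hv|u v hu hv]; first by rewrite hy ?mR //; lia.
by have hc := weight_cell hu hv; rewrite hy ?mW //; lia.
Qed.

Lemma Inv_regs P m m' : Inv P m ->
  (forall r, r \in [:: 0; 7; 8; 11; 12] -> m' r = m r) ->
  (forall y, 24 <= y -> m' y = m y) -> Inv P m'.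
Proof.
move=> I hr hy; apply: (Inv_ext I) => // [y hy'|x hx]; first by apply: hy; lia.
by rewrite hy; [case: I => _ [_ ->] | lia].
Qed.

Lemma Inv_code P m l : Inv P m ->
  all (fun i => if target i is Some a
                then (a < 24) && (a \notin [:: 0; 7; 8; 11; 12]) else false) l ->
  Inv P (run_code l m).
Proof.
move=> I hl; apply: (Inv_regs I) => [r hr|y hy].
  apply: run_frame; apply: sub_all hl => i; case: (target i) => // a /andP[_].
  by apply: contraNneq => ->.
by apply: (@run_heap 24) hy; apply: sub_all hl => i; case: (target i) => // a /andP[].
Qed.

Lemma Inv_upd P m r v : Inv P m ->
  (r < 24) && (r \notin [:: 0; 7; 8; 11; 12]) -> Inv P (upd m r v).
Proof. by move=> I hr; apply: (@Inv_code P m [:: IConst r v]) => //=; rewrite hr. Qed.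

Lemma run_ldP P t i x l m : Inv P m -> m i = x -> x < n -> t < 24 ->
  run_code (IAdd t 8 i :: ILoad t t :: l) m = run_code l (upd m t (P x)).
Proof.
move=> [[m0 m7 m8 m11 m12] [mR mP mW]] mi hx ht.
by rewrite run_load m8 mi ?mP //; lia.
Qed.

Lemma run_ldR P t i x l m : Inv P m -> m i = x -> x < n -> t < 24 ->
  run_code (IAdd t 7 i :: ILoad t t :: l) m = run_code l (upd m t (x * n + 1)).
Proof.
move=> [[m0 m7 m8 m11 m12] [mR mP mW]] mi hx ht.
by rewrite run_load m7 mi ?mR //; lia.
Qed.

Lemma run_ldW P t i j u v l m : Inv P m -> m i = u * n + 1 -> m j = v ->
  0 < u < n -> v < n -> t < 24 ->
  run_code (IAdd t i j :: ILoad t t :: l) m = run_code l (upd m t (W u v)).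
Proof.
move=> [[m0 m7 m8 m11 m12] [mR mP mW]] mi mj hu hv ht.
have hc := weight_cell hu hv.
rewrite run_load mi mj; first by rewrite addnAC mW.
lia.
Qed.

Lemma eval_bodyP P m x : Inv P m -> goodP n P -> m 5 = x -> 0 < x < n ->
  [/\ Inv P (run_code eval_body m), run_code eval_body m 10 = m 10 + term W n P x,
      run_code eval_body m 5 = x.-1 &
      forall r, r \in [:: 2; 3; 4; 6; 9; 20; 21; 22] -> run_code eval_body m r = m r].
Proof.
move=> I [P0 Pn Pi] m5 hx.
split; first exact: Inv_code.
3: by move=> r; rewrite !inE => hr; apply: run_frame;
  do 8?[case/orP: hr => [/eqP->//|hr]]; move/eqP: hr => ->.
all: have [[m0 m7 m8 m11 m12] _] := I.
all: have Px : 0 < P x < n by (have := Pn x; have := Pi x 0; rewrite P0; lia).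
all: rewrite /eval_body.
all: rewrite (@run_ldP P _ _ x) //; last lia.
all: set m1 := upd m 13 _; have I1 : Inv P m1 by apply: Inv_upd.
all: rewrite (@run_ldR P _ _ (P x)) //; last lia.
all: set m2 := upd m1 14 _; have I2 : Inv P m2 by apply: Inv_upd.
all: rewrite run_cons -[run_instr m2 _]/(upd m2 15 (m2 0 - m2 5)).
all: have -> : m2 0 - m2 5 = n - x by rewrite /m2 /m1 /upd /= m0 m5.
all: set m3 := upd m2 15 _; have I3 : Inv P m3 by apply: Inv_upd.
all: rewrite (@run_ldP P _ _ (n - x)) //; last lia.
all: set m4 := upd m3 16 _; have I4 : Inv P m4 by apply: Inv_upd.
all: rewrite (@run_ldW P _ _ _ (P x) (P (n - x))) //; last by apply: Pn; lia.
all: set m5' := upd m4 16 _; have I5 : Inv P m5' by apply: Inv_upd.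
all: rewrite run_cons -[run_instr m5' _]/(upd m5' 10 (m5' 10 + m5' 16)).
all: set m6 := upd m5' 10 _; have I6 : Inv P m6 by apply: Inv_upd.
all: rewrite run_cons -[run_instr m6 _]/(upd m6 15 (m6 15 - m6 12)).
all: have -> : m6 15 - m6 12 = n.-1 - x
  by rewrite /m6 /m5' /m4 /m3 /m2 /m1 /upd /= m12; lia.
all: set m7' := upd m6 15 _; have I7 : Inv P m7' by apply: Inv_upd.
all: rewrite (@run_ldP P _ _ (n.-1 - x)) //; last lia.
all: set m8' := upd m7' 16 _; have I8 : Inv P m8' by apply: Inv_upd.
all: rewrite (@run_ldW P _ _ _ (P x) (P (n.-1 - x))) //; last by apply: Pn; lia.
all: rewrite /run_code /= /m8' /m7' /m6 /m5' /m4 /m3 /m2 /m1 /upd /=.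
  by rewrite /term; lia.
by rewrite m12 m5; lia.
Qed.

Lemma swap_codeP P m i j x y : Inv P m -> m i = x -> m j = y -> x < n -> y < n ->
  i < 24 -> j < 24 -> i \notin [:: 13; 14; 15; 16] -> j \notin [:: 13; 14; 15; 16] ->
  Inv (swap_at P x y) (run_code (swap_code i j) m) /\
  (forall r, r < 24 -> r \notin [:: 13; 14; 15; 16] -> run_code (swap_code i j) m r = m r).
Proof.
move=> I mi mj hx hy i24 j24; rewrite !inE => hi hj.
have [[m0 m7 m8 m11 m12] [mR mP mW]] := I.
set m' := run_code _ m.
have m'E z : m' z = if z == PB + y then P x else if z == PB + x then P y else
  run_code [:: IAdd 13 8 i; IAdd 14 8 j; ILoad 15 13; ILoad 16 14] m z.
  rewrite /m' /swap_code /run_code /=; set m1 := upd m 13 _.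
  have e1 : m1 8 + m1 j = PB + y by rewrite /m1 /upd ifN ?ifN ?m8 ?mj //; lia.
  rewrite e1; set m2 := upd m1 14 _; set m3 := upd m2 15 _; set m4 := upd m3 16 _.
  have -> : m4 13 = PB + x by rewrite /m4 /m3 /m2 /m1 /upd /= m8 mi.
  have e15 : m4 15 = P x.
    by rewrite /m4 /m3 /m2 /m1 /upd /= m8 mi !ifN ?mP //; lia.
  have e16 : m4 16 = P y.
    by rewrite /m4 /m3 /m2 /m1 /upd /= !ifN ?mP //; lia.
  rewrite e16 ![upd m4 _ _ _]upd_ne; try lia.
  by rewrite e15 {1}/upd (_ : m4 14 = PB + y).
split.
  apply: (Inv_ext I) => [r hr|z hz|z hz].
  - rewrite m'E !ifN; try (by move: hr; rewrite !inE; lia).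
    by apply: run_frame => /=; move: hr; rewrite !inE; lia.
  - rewrite m'E !ifN; try lia.
    by apply: (@run_heap 24) => //; lia.
  rewrite m'E !eqn_add2l /swap_at.
  case: eqP => // _; case: eqP => // _.
  by rewrite -mP //; apply: (@run_heap 24) => //; lia.
move=> r hr nr; rewrite m'E !ifN; try lia.
by apply: run_frame => /=; move: nr; rewrite !inE; lia.
Qed.

Definition keep (rs : seq nat) (m m' : mem_t) : Prop := forall r, r \in rs -> m' r = m r.

Lemma countdown_sum (F : nat -> nat) k s :
  countdown (fun x s => s + F x) k s = s + \sum_(1 <= x < k.+1) F x.
Proof.
elim: k s => [|k IH] s /=; first by rewrite big_geq // addn0.
by rewrite IH [in RHS]big_nat_recr //= -addnA [F _ + _]addnC.
Qed.

Lemma eval_codeP P m : Inv P m -> goodP n P ->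
  wp eval_code m (fun m' => [/\ Inv P m', m' 10 = Phi W n P &
    keep [:: 2; 3; 4; 6; 9; 20; 21; 22] m m']) (24 * n + 3).
Proof.
move=> I gP.
apply: (@wp_weaken _ _ _ _ (2 + (n.-1 * (21 + 3) + 1)) _ _ _ (fun _ h => h)); last lia.
apply: wp_seq; apply: wp_code => //; set m1 := run_code _ m.
have I1 : Inv P m1 by apply: Inv_code.
have m15 : m1 5 = n.-1.
  by case: I => [[m0 _ _ _ m12] _]; rewrite /m1 /run_code /= /upd /= m0 m12; lia.
set J := fun s m' => [/\ Inv P m', m' 10 = s & keep [:: 2; 3; 4; 6; 9; 20; 21; 22] m m'].
apply: wp_weaken (@wp_while _ (fun x s => s + term W n P x) J 5 (Code eval_body) 21 n.-1 0 m1 _ _ _ _ _) _ _ => //.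
- move=> s m' [I' e' k']; split; [exact: Inv_upd | by rewrite upd_ne |].
  by move=> r hr; rewrite upd_ne ?k' //; move: hr; rewrite !inE; lia.
- move=> j s m' hj [I' e' k'] m'5; apply: wp_code => //.
  have [I'' e10 e5 k''] := eval_bodyP I' gP m'5 ltac:(lia).
  by split=> //; split=> // [|r hr]; [rewrite e10 e' | rewrite k'' ?k'].
- split=> // r hr; rewrite /m1; apply: run_frame => /=.
  by move: hr; rewrite !inE; lia.
move=> m' [[I' e' k'] _]; split=> //.
by rewrite e' countdown_sum add0n /Phi prednK //; lia.
Qed.

Lemma try_codeP P m a b c : Inv P m -> goodP n P ->
  m 9 = Phi W n P -> m 2 = a -> m 3 = b -> m 4 = c ->
  0 < a < n.-1 -> 0 < b < n.-1 -> 0 < c < n.-1 ->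
  wp try_code m (fun m' => [/\ Inv (try W n a b c P) m', m' 9 = Phi W n (try W n a b c P),
    m' 4 = c.-1 & keep [:: 2; 3; 6] m m']) (25 * n + 40).
Proof.
move=> I gP m9 m2 m3 m4 ha hb hc; have [[m0 m7 m8 m11 m12] _] := I.
apply: (@wp_weaken _ _ _ _ (15 + ((24 * n + 3) + (1 + ((12 + 3) + 1)))) _ _ _ (fun _ h => h)); last lia.
apply: wp_seq; apply: wp_code => //.
rewrite run_cat run_cat.
set m1 := run_code _ m; set m2' := run_code _ m1; set m3' := run_code _ m2'.
have I1 : Inv P m1 by apply: Inv_code.
have e20 : m1 20 = n.-1 - a by rewrite /m1 /run_code /= /upd /= m11 m2.
have e21 : m1 21 = n.-1 - b by rewrite /m1 /run_code /= /upd /= m11 m3.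
have e22 : m1 22 = n.-1 - c by rewrite /m1 /run_code /= /upd /= m11 m4.
have k1 : keep [:: 2; 3; 4; 6; 9] m m1.
  by move=> r hr; apply: run_frame => /=; move: hr; rewrite !inE; lia.
have e4 : m1 4 = c by rewrite k1.
have [I2 k2] := swap_codeP I1 e20 e4 ltac:(lia) ltac:(lia) isT isT isT isT.
have f21 : m2' 21 = n.-1 - b by rewrite /m2' k2.
have f22 : m2' 22 = n.-1 - c by rewrite /m2' k2.
have [I3 k3] := swap_codeP I2 f21 f22 ltac:(lia) ltac:(lia) isT isT isT isT.
have k13 : forall r, r \in [:: 2; 3; 4; 6; 9; 20; 21; 22] -> m3' r = m1 r.
  by move=> r hr; rewrite /m3' k3 ?k2 //; move: hr; rewrite !inE; lia.
have gmv := goodP_mv gP ha hb hc.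
have {}I3 : Inv (rematch n a b c P) m3' by exact: I3.
apply: wp_seq; apply: wp_weaken (eval_codeP I3 gmv) (leqnn _) _ => m5 [I5 e5 k5].
apply: wp_seq; apply: wp_code => //.
set m6 := run_code _ m5.
have I6 : Inv (rematch n a b c P) m6 by apply: Inv_code.
have k56 r : r != 13 -> m6 r = m5 r.
  by move=> hr; apply: run_frame; rewrite /= eq_sym hr.
have m5_9 : m5 9 = Phi W n P by rewrite k5 // k13 // k1.
have e13 : m6 13 = Phi W n P - Phi W n (rematch n a b c P).
  by rewrite /m6 /run_code /= /upd /= m5_9 e5.
have k6 r : r \in [:: 2; 3; 4; 6; 9; 20; 21; 22] -> m6 r = m1 r.
  by move=> hr; rewrite k56 ?k5 ?k13 //; move: hr; rewrite !inE; lia.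
apply: wp_seq.
set Q := fun m' => [/\ Inv (try W n a b c P) m', m' 9 = Phi W n (try W n a b c P),
   m' 4 = c & keep [:: 2; 3; 6] m m'].
have Q1 m' : Q m' -> Q (upd m' 1 0).
  move=> [I' e9 ec k']; split; [exact: Inv_upd | by rewrite upd_ne | by rewrite upd_ne |].
  by move=> r hr; rewrite upd_ne ?k' //; move: hr; rewrite !inE; lia.
have QQ m' : Q m' -> wp (Code [:: ISub 4 4 12]) m' (fun m' =>
   [/\ Inv (try W n a b c P) m', m' 9 = Phi W n (try W n a b c P),
    m' 4 = c.-1 & keep [:: 2; 3; 6] m m']) 1.
  move=> [I' e9 ec k']; apply: wp_code => //; split; first exact: Inv_code.
  - by rewrite run_frame.
  - by case: I' => [[_ _ _ _ e12] _]; rewrite /run_code /= /upd /= ec e12; lia.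
  by move=> r hr; rewrite run_frame ?k' //=; move: hr; rewrite !inE; lia.
apply: wp_weaken (leqnn _) QQ; apply: (wp_if _ Q1).
  move=> nz; apply: wp_code => //.
  have T : Phi W n (rematch n a b c P) < Phi W n P by lia.
  rewrite /Q /try T; split; first exact: Inv_code.
  - by rewrite /run_code /= /upd /= addn0 k56 // e5.
  - by rewrite run_frame // k6.
  by move=> r hr; rewrite run_frame; [rewrite k6 ?k1 //|]; move: hr; rewrite /= !inE; lia.
move=> z; apply: wp_code; [by [] | by [] |].
have T : Phi W n (rematch n a b c P) < Phi W n P = false by lia.
rewrite /Q /try T.
rewrite run_cat.
have g21 : m6 21 = n.-1 - b by rewrite k6.
have g22 : m6 22 = n.-1 - c by rewrite k6.
have [I7 k7] := swap_codeP I6 g21 g22 ltac:(lia) ltac:(lia) isT isT isT isT.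
have g20 : run_code (swap_code 21 22) m6 20 = n.-1 - a by rewrite k7 // k6.
have g4 : run_code (swap_code 21 22) m6 4 = c by rewrite k7 // k6.
have [I8 k8] := swap_codeP I7 g20 g4 ltac:(lia) ltac:(lia) isT isT isT isT.
have kk r : r \in [:: 2; 3; 4; 6; 9] -> run_code (swap_code 20 4) (run_code (swap_code 21 22) m6) r = m r.
  by move=> hr; rewrite k8 ?k7 ?k6 ?k1 //; move: hr; rewrite !inE; lia.
split; [by move: I8; rewrite /rematch !swp_swp | by rewrite kk | by rewrite kk |].
by move=> r hr; rewrite kk //; move: hr; rewrite !inE; lia.
Qed.

End Evaluation.

(** * The nested loops over all moves and their running time *)

Section Search.

Variables (n : nat) (W : nat -> nat -> nat).
Hypothesis n24 : 24 <= n.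
Local Notation Inv := (Inv n W).
Local Notation RB := (n * n + 1).
Local Notation PB := (n * n + n + 1).

Definition search_inv (P m : mem_t) : Prop := [/\ Inv P m, goodP n P & m 9 = Phi W n P].

Lemma search_inv_upd P m r v : search_inv P m -> (r < 24) && (r \notin [:: 0; 7; 8; 9; 11; 12]) ->
  search_inv P (upd m r v).
Proof.
move=> [I gP e9]; rewrite !inE => hr; split=> //.
  by apply: Inv_upd => //; rewrite !inE; lia.
by rewrite upd_ne //; lia.
Qed.

Lemma keep_upd rs m m' r v : keep rs m m' -> r \notin rs -> keep rs m (upd m' r v).
Proof.
by move=> k nr s hs; rewrite upd_ne ?k // => e; rewrite -e hs in nr.
Qed.

(** [rs] lists the counters of the enclosing loops; they must keep the values they have in the
    reference memory [m0]. *)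
Lemma loop_codeP (rs : seq nat) (r : nat) (F : frag) (f : nat -> mem_t -> mem_t)
    (T : nat) (P m0 m : mem_t) :
  (r < 24) && (r \notin [:: 0; 1; 7; 8; 9; 11; 12]) -> r \notin rs -> 1 \notin rs ->
  (forall j Q m', 0 < j < n.-1 -> search_inv Q m' -> keep rs m0 m' -> m' r = j ->
     wp F m' (fun m'' => [/\ search_inv (f j Q) m'', m'' r = j.-1 & keep rs m' m'']) T) ->
  search_inv P m -> keep rs m0 m ->
  wp (loop_code r F) m (fun m' => search_inv (countdown f n.-2 P) m' /\ keep rs m0 m') (n * (T + 3)).
Proof.
rewrite !inE => hr nr n1 hF S k.
apply: (@wp_weaken _ _ _ _ (1 + (n.-2 * (T + 3) + 1)) _ _ _ (fun _ h => h)); last nia.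
apply: wp_seq; apply: wp_code => //.
have -> : run_code [:: ISub r 11 12] m = upd m r n.-2.
  have [[[_ _ _ e11 e12] _] _ _] := S.
  by rewrite /run_code /= e11 e12 subn1.
set J := fun Q m' => search_inv Q m' /\ keep rs m0 m'.
apply: wp_weaken (@wp_while _ f J r F T n.-2 P (upd m r n.-2) _ _ _ _ _) (leqnn _) _.
- by lia.
- by move=> Q m' [SQ kQ]; split; [exact: search_inv_upd | exact: keep_upd].
- move=> j Q m' hj [SQ kQ] m'r.
  apply: wp_weaken (hF j.+1 Q m' _ SQ kQ m'r) (leqnn _) _; first lia.
  by move=> m'' [S'' -> k'']; split=> //; split=> // s hs; rewrite k'' ?kQ.
- by split; [apply: search_inv_upd => //; rewrite !inE; lia | exact: keep_upd].
- by rewrite /upd eqxx.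
by move=> m' [].
Qed.

Lemma down_codeP (rs : seq nat) r P m j : search_inv P m -> m r = j ->
  (r < 24) && (r \notin [:: 0; 1; 7; 8; 9; 11; 12]) -> r \notin rs ->
  wp (down_code r) m (fun m' => [/\ search_inv P m', m' r = j.-1 & keep rs m m']) 1.
Proof.
move=> S mr; rewrite !inE => hr nr; apply: wp_code => //.
have -> : run_code [:: ISub r r 12] m = upd m r j.-1.
  have [[[_ _ _ _ e12] _] _ _] := S.
  by rewrite /run_code /= e12 mr subn1.
split; first by apply: search_inv_upd => //; rewrite !inE; lia.
  by rewrite /upd eqxx.
exact: keep_upd.
Qed.

Lemma loop_down (rs : seq nat) r r' F (g : mem_t -> mem_t) P m0 m j T :
  wp (loop_code r F) m (fun m' => search_inv (g P) m' /\ keep (r' :: rs) m0 m') T ->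
  m0 r' = j ->
  (r' < 24) && (r' \notin [:: 0; 1; 7; 8; 9; 11; 12]) -> r' \notin rs ->
  wp (Seq (loop_code r F) (down_code r')) m
    (fun m' => [/\ search_inv (g P) m', m' r' = j.-1 & keep rs m0 m']) (T + 1).
Proof.
move=> h m0r hr nr; apply: wp_seq; apply: wp_weaken h (leqnn _) _ => m1 [S1 k1].
have m1r : m1 r' = j by rewrite k1 // inE eqxx.
apply: wp_weaken (@down_codeP rs r' _ _ j S1 m1r hr nr) (leqnn _) _ => m2 [S2 e2 k2].
by split=> // s hs; rewrite k2 // k1 // inE hs orbT.
Qed.

Lemma pass_codeP P m : search_inv P m ->
  wp pass_code m (fun m' => search_inv (pass W n P) m' /\ m' 6 = (m 6).-1) (60 * n ^ 4).
Proof.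
move=> S.
set Tc := n * (25 * n + 40 + 3); set Tb := n * (Tc + 1 + 3); set Ta := n * (Tb + 1 + 3).
apply: (@wp_weaken _ _ _ _ (Ta + 1) _ _ _ (fun _ h => h)); last first.
  rewrite /Ta /Tb /Tc; nia.
apply: wp_weaken (@loop_down [::] 2 6 _ (pass W n) P m m (m 6) Ta _ erefl isT isT) (leqnn _) _; last first.
  by move=> m' [].
apply: (@loop_codeP [:: 6]) => // a Qa ma ha Sa ka m2a.
apply: (@loop_down [:: 6] 3 2 _ (countdown (fun b => countdown (fun c => try W n a b c) n.-2) n.-2)) => //.
apply: (@loop_codeP [:: 2; 6]) => // b Qb mb hb Sb kb m3b.
apply: (@loop_down [:: 2; 6] 4 3 _ (countdown (fun c => try W n a b c) n.-2)) => //.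
apply: (@loop_codeP [:: 3; 2; 6]) => // c Qc mc hc [Ic gc ec] kc m4c.
apply: wp_weaken (try_codeP n24 Ic gc ec _ _ m4c ha hb hc) (leqnn _) _.
- by rewrite kc // kb.
- by rewrite kc.
move=> m' [I' e9 e4 k']; split=> //; first by split=> //; apply: goodP_try.
by move=> r hr; apply: k'; move: hr; rewrite !inE; lia.
Qed.

Lemma countdown_iter S (g : S -> S) k s : countdown (fun=> g) k s = iter k g s.
Proof. by elim: k s => //= k IH s; rewrite IH -iterS -iterSr. Qed.

Lemma searchP P m k : search_inv P m -> m 6 = k ->
  wp (While 6 pass_code) m (fun m' => search_inv (iter k (pass W n) P) m') (k * (60 * n ^ 4 + 3) + 1).
Proof.
move=> S m6.
apply: wp_weaken (@wp_while _ (fun=> pass W n) search_inv 6 pass_code (60 * n ^ 4) k P m _ _ _ _ _) (leqnn _) _ => //.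
- by move=> Q m' SQ; apply: search_inv_upd.
- move=> j Q m' hj SQ e; apply: wp_weaken (pass_codeP SQ) (leqnn _) _ => m'' [S'' ->].
  by rewrite e.
by move=> m'; rewrite countdown_iter => -[].
Qed.

End Search.

(** * Initialisation of the tables and output of the cycle *)

Section Phases.

Variables (n : nat) (W : nat -> nat -> nat).
Hypothesis n24 : 24 <= n.
Local Notation Inv := (Inv n W).
Local Notation search_inv := (search_inv n W).
Local Notation RB := (n * n + 1).
Local Notation PB := (n * n + n + 1).

Lemma leq_sqr : n <= n * n.
Proof. by rewrite leq_pmulr //; lia. Qed.

Definition square_inv (m : mem_t) (s : nat) (m' : mem_t) : Prop :=
  [/\ m' 0 = n, m' 7 = s, m' 11 = n.-1, m' 12 = 1 & m' 13 = 0] /\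
  forall y, 24 <= y -> m' y = m y.

Lemma square_codeP m : m 5 = n -> square_inv m 1 m ->
  wp (While 5 (Code [:: IAdd 7 7 0; ISub 5 5 12])) m (square_inv m RB) (5 * n + 1).
Proof.
move=> m5 J.
apply: wp_weaken (@wp_while _ (fun=> addn^~ n) (square_inv m) 5 _ 2 n 1 m _ _ _ J m5) _ _ => //; last 1 first.
- have -> : countdown (fun=> addn^~ n) n 1 = RB; last by move=> m' [].
  have : forall k s, countdown (fun=> addn^~ n) k s = s + k * n.
    by elim=> [|k IH] s /=; rewrite ?IH; lia.
  by move=> ->; lia.
- by move=> s m' [[? ? ? ? ?] h]; split=> // y hy; rewrite upd_ne ?h //; lia.
- move=> j s m' hj [[e0 e7 e11 e12 e13] h] e5; apply: wp_code => //; split; last first.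
    by rewrite /run_code /= /upd /= e5 e12; lia.
  split; last by move=> y hy; rewrite (@run_heap 24) ?h.
  by split; rewrite /run_code /= /upd /= ?e7 ?e0.
by lia.
Qed.

Definition fill_inv (m : mem_t) (i : nat) (m' : mem_t) : Prop :=
  [/\ m' 0 = n, m' 7 = RB, m' 8 = PB, m' 11 = n.-1 & m' 12 = 1] /\
  [/\ i + m' 5 = n, m' 13 = i, m' 14 = i * n + 1,
      forall y, 24 <= y < RB -> m' y = m y &
      forall v, v < i -> m' (RB + v) = v * n + 1 /\ m' (PB + v) = v].

Lemma fill_bodyE m i : m 7 = RB -> m 8 = PB -> m 13 = i -> i < n ->
  forall y, 16 <= y -> run_code fill_body m y =
    if y == PB + i then i else if y == RB + i then m 14 else m y.
Proof.
move=> m7 m8 m13 hi y hy; rewrite /fill_body /run_code /=.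
set m1 := upd m 15 _; have -> : m1 15 = RB + i by rewrite /m1 /upd /= m7 m13.
have -> : m1 14 = m 14 by [].
set m2 := upd m1 _ _.
have m2r r : r < 24 -> m2 r = m1 r by move=> hr; rewrite /m2 upd_ne //; lia.
rewrite !m2r //; set m3 := upd m2 15 _.
have -> : m3 15 = PB + i by rewrite /m3 /m1 /upd /= m8 m13.
have -> : m3 13 = i by rewrite /m3 upd_ne // m2r.
set m4 := upd m3 _ _.
rewrite ![upd _ _ _ y]upd_ne; try lia.
rewrite /m4 {1}/upd; case: eqP => // ne.
rewrite /m3 upd_ne; last lia.
rewrite /m2 {1}/upd; case: eqP => // ne'.
by rewrite /m1 upd_ne; last lia.
Qed.

Lemma fill_bodyR m i : m 7 = RB -> m 8 = PB -> m 13 = i -> i < n ->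
  [/\ forall r, r \in [:: 0; 7; 8; 11; 12] -> run_code fill_body m r = m r,
      run_code fill_body m 5 = m 5 - m 12, run_code fill_body m 13 = i + m 12 &
      run_code fill_body m 14 = m 14 + m 0].
Proof.
move=> m7 m8 m13 hi; rewrite /fill_body /run_code /=.
set m1 := upd m 15 _; have -> : m1 15 = RB + i by rewrite /m1 /upd /= m7 m13.
have -> : m1 14 = m 14 by [].
set m2 := upd m1 _ _.
have m2r r : r < 24 -> m2 r = m1 r by move=> hr; rewrite /m2 upd_ne //; lia.
rewrite !m2r //; set m3 := upd m2 15 _.
have -> : m3 15 = PB + i by rewrite /m3 /m1 /upd /= m8 m13.
have -> : m3 13 = i by rewrite /m3 upd_ne // m2r.
set m4 := upd m3 _ _.
have m4r r : r < 24 -> r <> 15 -> m4 r = m r.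
  move=> hr ne; rewrite /m4 upd_ne; last lia.
  by rewrite /m3 upd_ne // m2r // /m1 upd_ne.
split; try by rewrite /upd /= !m4r // m13.
move=> r hr; rewrite !upd_ne ?m4r //; move: hr; rewrite !inE; lia.
Qed.

Lemma fill_codeP m : m 5 = n -> fill_inv m 0 m ->
  wp (While 5 (Code fill_body)) m (fill_inv m n) (10 * n + 1).
Proof.
move=> m5 J.
apply: wp_weaken (@wp_while _ (fun=> succn) (fill_inv m) 5 _ 7 n 0 m _ _ _ J m5) _ _ => //; last 1 first.
- have -> : countdown (fun=> succn) n 0 = n; last by move=> m' [].
  have : forall k s, countdown (fun=> succn) k s = s + k.
    by elim=> [|k IH] s /=; rewrite ?IH; lia.
  by move=> ->.
- move=> s m' [? [e5 e13 e14 h h']]; split=> //; split=> // [y hy|v hv].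
    by rewrite upd_ne ?h //; lia.
  by have hn := leq_sqr; rewrite !upd_ne; [exact: h' | lia..].
- move=> j i m' hj [[e0 e7 e8 e11 e12] [e5 e13 e14 h h']] e5'; apply: wp_code => //.
  have hi : i < n by lia.
  have hn := leq_sqr.
  have [hr f5 f13 f14] := fill_bodyR e7 e8 e13 hi.
  have hy := fill_bodyE e7 e8 e13 hi.
  split; last by rewrite f5; lia.
  split; first by rewrite !hr.
  split; [by rewrite f5; lia | by rewrite f13 e12; lia | by rewrite f14 e14 e0; lia | |].
    by move=> y hy'; rewrite hy ?ifN ?h //; lia.
  move=> v hv; rewrite !hy; try lia.
  rewrite !eqn_add2l ifN; last lia.
  have [->|ne] := eqVneq v i; first by rewrite e14.
  rewrite ifN; last lia.
  by apply: h'; lia.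
by lia.
Qed.

Lemma goodP_id : goodP n id.
Proof. by split. Qed.

Lemma init_codeP m : m 0 = n ->
  (forall u v, 0 < u < n -> v < n -> m (u * n + v + 1) = W u v) ->
  wp init_code m (fun m' => search_inv id m' /\ m' 6 = 8 * n) (50 * n).
Proof.
move=> m0 mW.
apply: (@wp_weaken _ _ _ _ (5 + ((5 * n + 1) + (3 + ((10 * n + 1) + ((24 * n + 3) + 5))))) _ _ _ (fun _ h => h)); last lia.
apply: wp_seq; apply: wp_code => //; set m1 := run_code _ m.
have h1 y : 24 <= y -> m1 y = m y by apply: run_heap.
apply: wp_seq; apply: wp_weaken (@square_codeP m1 _ _) (leqnn _) _.
- by rewrite /m1 /run_code /= /upd /= m0 addn0.
- by split=> //; split; rewrite /m1 /run_code /= /upd /= ?m0; lia.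
move=> m2 [[e0 e7 e11 e12 e13] h2].
apply: wp_seq; apply: wp_code => //; set m3 := run_code _ m2.
have h3 y : 24 <= y -> m3 y = m2 y by apply: run_heap.
apply: wp_seq; apply: wp_weaken (@fill_codeP m3 _ _) (leqnn _) _.
- by rewrite /m3 /run_code /= /upd /= e0 e13 addn0.
- by split; split=> //; rewrite /m3 /run_code /= /upd /= ?e0 ?e7 ?e13; lia.
move=> m4 [[f0 f7 f8 f11 f12] [f5 f13 f14 h4 h4']].
have I4 : Inv id m4.
  split=> //; split=> [v hv|v hv|u v hu hv]; try by case: (h4' _ hv).
  by have hc := weight_cell n24 hu hv; rewrite h4 // h3 ?h2 ?h1 ?mW //; lia.
apply: wp_seq; apply: wp_weaken (eval_codeP n24 I4 goodP_id) (leqnn _) _.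
move=> m5 [I5 e10 _]; apply: wp_code => //; split.
  split; [exact: Inv_code | exact: goodP_id |].
  by rewrite /run_code /= /upd /= addn0.
by have [[g0 _ _ _ _] _] := I5; rewrite /run_code /= /upd /= g0; lia.
Qed.

Local Notation OB := (n * n + n + 1 + n).

Definition zig_inv (P m' : mem_t) : Prop :=
  [/\ Inv P m', m' 19 = OB, m' 5 <= n & forall i, m' 5 <= i < n ->
    m' (OB + i.*2) = P i /\ m' (OB + i.*2 + 1) = P (n.-1 - i)].

Lemma zig_bodyP P m k : zig_inv P m -> m 5 = k.+1 ->
  zig_inv P (run_code zig_body m) /\ run_code zig_body m 5 = k.
Proof.
move=> [I e19 le5 h] m5; have [[m0 m7 m8 m11 m12] _] := I.
rewrite /zig_body run_cons -[run_instr m _]/(upd m 13 (m 5 - m 12)).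
have -> : m 5 - m 12 = k by rewrite m5 m12; lia.
set m1 := upd m 13 k; have I1 : Inv P m1 by apply: Inv_upd.
rewrite (@run_ldP n W n24 P _ _ k) //; last lia.
set m2 := upd m1 14 _; have I2 : Inv P m2 by apply: Inv_upd.
rewrite run_cons -[run_instr m2 _]/(upd m2 15 (m 0 - m 5)).
have -> : m 0 - m 5 = n.-1 - k by rewrite m0 m5; lia.
set m3 := upd m2 15 _; have I3 : Inv P m3 by apply: Inv_upd.
rewrite (@run_ldP n W n24 P _ _ (n.-1 - k)) //; last lia.
set m4 := upd m3 15 _; have I4 : Inv P m4 by apply: Inv_upd.
have m4E y : y <> 13 -> y <> 14 -> y <> 15 -> m4 y = m y.
  by move=> *; rewrite /m4 /m3 /m2 /m1 !upd_ne.
set m' := run_code _ m4.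
have m'E y : y <> 16 -> m' y = if y == 5 then k else if y == OB + k.*2 + 1 then P (n.-1 - k) else
     if y == OB + k.*2 then P k else m4 y.
  move=> ne; rewrite /m' /run_code /=.
  set m5' := upd m4 16 _; set m6 := upd m5' 16 _.
  have -> : m6 16 = OB + k.*2.
    by rewrite /m6 /m5' /m4 /m3 /m2 /m1 /upd /= e19; lia.
  have -> : m6 14 = P k by [].
  set m7' := upd m6 _ _.
  have r7 r : r < 24 -> m7' r = m6 r by move=> hr; rewrite /m7' upd_ne //; lia.
  have -> : m7' 16 + m7' 12 = OB + k.*2 + 1.
    by rewrite !r7 // /m6 /m5' /m4 /m3 /m2 /m1 /upd /= e19 m12; lia.
  set m8' := upd m7' 16 _.
  have -> : m8' 15 = P (n.-1 - k) by rewrite /m8' upd_ne // r7.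
  have -> : m8' 16 = OB + k.*2 + 1 by [].
  set m9 := upd m8' _ _.
  have r9 r : r < 16 -> m9 r = m4 r.
    move=> hr; rewrite /m9 upd_ne; last lia.
    rewrite /m8' upd_ne; last lia.
    rewrite r7; last lia.
    by rewrite /m6 /m5' !upd_ne; lia.
  rewrite {1}/upd; case: eqP => [_|ne5]; first by rewrite !r9 // !m4E // m5 m12; lia.
  rewrite /m9 {1}/upd; case: eqP => // _.
  rewrite /m8' upd_ne // /m7' {1}/upd; case: eqP => // _.
  by rewrite /m6 /m5' !upd_ne.
have I' : Inv P m'.
  apply: (Inv_ext n24 I4) => [r hr|y hy|x hx]; last first.
  - rewrite m'E; last lia.
    by rewrite !ifN; try lia; case: I4 => _ [_ ->].
  - by rewrite m'E; [rewrite !ifN //; lia | lia].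
  have {}hr : r < 16 /\ r != 5 by move: hr; rewrite !inE; lia.
  by rewrite m'E; [rewrite !ifN //; lia | lia].
split; last by rewrite m'E.
split=> //.
- by rewrite m'E // !ifN ?m4E //; lia.
- by rewrite m'E //=; lia.
move=> i; rewrite {1}m'E //= => hi; rewrite !m'E; try lia.
have [->|ne] := eqVneq i k.
  split; rewrite ifN; try lia; rewrite ?eqxx //.
  by rewrite ifN //; lia.
rewrite !ifN; try lia.
rewrite !m4E; try lia.
by apply: h; lia.
Qed.

Lemma zig_codeP P m : zig_inv P m -> m 5 = n ->
  wp (While 5 (Code zig_body)) m (fun m' => m' 12 = 1 /\ m' 0 = n /\ m' 19 = OB /\
     forall i, i < n -> m' (OB + i) = P (zig n i)) (15 * n + 1).
Proof.
move=> J m5.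
apply: wp_weaken (@wp_while _ (fun=> id) (fun _ : unit => zig_inv P) 5 _ 12 n tt m _ _ _ J m5) _ _ => //.
- move=> _ m' [I' e19 e5 h]; split=> //; first exact: Inv_upd.
  by move=> i hi; rewrite !upd_ne; [apply: h | lia..].
- move=> j [] m' hj J' m'5; apply: wp_code => //.
  exact: zig_bodyP.
- by lia.
move=> m' [[[[m0 _ _ _ m12] _] e19 _ h] m'5]; do 3!split=> //.
move=> i hi; have [h1 h2] := h i./2 ltac:(lia).
by rewrite /zig; case: ifP => oi; [rewrite -h2|rewrite -h1]; congr m'; lia.
Qed.

Definition copy_inv (m m' : mem_t) : Prop :=
  [/\ m' 12 = 1, m' 13 = 23, m' 19 = OB, m' 5 <= n &
     forall y, 24 <= y -> m' y = if 23 + m' 5 < y <= 23 + n then m (OB + y) else m y].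

Lemma copy_codeP m : copy_inv m m -> m 5 = n ->
  wp (While 5 (Code copy_body)) m
     (fun m' => m' 19 = OB /\ forall y, 24 <= y -> 
        m' y = if y <= 23 + n then m (OB + y) else m y) (8 * n + 1).
Proof.
move=> J m5.
apply: wp_weaken (@wp_while _ (fun=> id) (fun _ : unit => copy_inv m) 5 _ 5 n tt m _ _ _ J m5) _ _ => //.
- move=> _ m' [e12 e13 e19 e5 h]; split=> // y hy.
  by rewrite upd_ne; [apply: h | lia].
- move=> j [] m' hj [e12 e13 e19 e5 h] m'5; apply: wp_code => //.
  have E y : 16 < y \/ y \in [:: 5; 12; 13] -> run_code copy_body m' y =
     if y == 5 then j else if y == 24 + j then m (OB + (24 + j)) else m' y.
    move=> hy; rewrite /copy_body run_cons -[run_instr m' _]/(upd m' 14 (m' 13 + m' 5)).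
    have -> : m' 13 + m' 5 = 24 + j by rewrite e13 m'5; lia.
    set m1 := upd m' 14 _.
    rewrite run_load; last by rewrite /m1 /upd /= e19; lia.
    have -> : m1 19 + m1 14 = OB + (24 + j) by rewrite /m1 /upd /= e19.
    (* The source lies above [23 + n], beyond every destination, so earlier rounds have not touched
       it. *)
    have -> : m1 (OB + (24 + j)) = m (OB + (24 + j)).
      rewrite /m1 upd_ne; last lia.
      rewrite h; last lia.
      by rewrite ifN; last lia.
    rewrite /run_code /=; set m2 := upd m1 15 _.
    have -> : m2 14 = 24 + j by [].
    have -> : m2 15 = m (OB + (24 + j)) by [].
    rewrite {1}/upd; case: eqP => [_|ne].
      by rewrite /m2 /m1 !upd_ne; [rewrite e12 m'5; lia | lia..].
    rewrite {1}/upd; case: eqP => // ne'.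
    have : y <> 14 /\ y <> 15 by case: hy => [|]; [lia | rewrite !inE; lia].
    by case=> n14 n15; rewrite /m2 /m1 !upd_ne.
  have E5 : run_code copy_body m' 5 = j by rewrite E //; right.
  split=> //; split; [by rewrite E; [|right] | by rewrite E; [|right]
    | by rewrite E; [|left] | by rewrite E5; lia |].
  move=> y hy; rewrite E5 E; last by left; lia.
  rewrite ifN; last lia.
  have [->|ne] := eqVneq y (24 + j); first by rewrite ifT //; lia.
  rewrite h //; congr (if _ then _ else _); lia.
- by lia.
move=> m' [[_ _ e19 _ h] m'5]; split=> // y hy.
by rewrite h // m'5 addn0 hy.
Qed.

Lemma low_codeE (B : nat) l m : 24 <= B -> uniq l -> all (fun a => 0 < a < 24) l ->
  m 0 = B -> forall y, run_code (low_code l) m y = if y \in l then m (B + y) else m y.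
Proof.
move=> B24; elim: l m => [|a l IH] m // /andP[al ul] /andP[ha hl] m0 y.
rewrite -[low_code _]/(IConst a a :: IAdd a a 0 :: ILoad a a :: low_code l).
rewrite run_cons -[run_instr m _]/(upd m a a).
have m1 : upd m a a a = a by rewrite /upd eqxx.
have m1' : upd m a a 0 = B by rewrite upd_ne //; lia.
rewrite run_load m1 m1'; last lia.
rewrite upd_upd [a + B]addnC [upd m a a _]upd_ne; last lia.
rewrite IH //; last by rewrite upd_ne //; lia.
rewrite inE; have [->|ne] /= := eqVneq y a.
  by rewrite (negPf al) /upd eqxx.
case: ifP => yl; rewrite upd_ne //; last by apply/eqP.
have := allP hl _ yl; lia.
Qed.

Lemma finish_codeP P m : search_inv P m ->
  wp finish_code m (fun m' => forall i, i < n -> m' i = P (zig n i)) (40 * n).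
Proof.
move=> [I gP _].
apply: (@wp_weaken _ _ _ _ (3 + ((15 * n + 1) + (3 + ((8 * n + 1) + 72)))) _ _ _ (fun _ h => h)); last lia.
have [[m0 m7 m8 m11 m12] _] := I.
apply: wp_seq; apply: wp_code => //; set m1 := run_code _ m.
have m15 : m1 5 = n by rewrite /m1 /run_code /= /upd /= m0 addn0.
apply: wp_seq; apply: wp_weaken (@zig_codeP P m1 _ m15) (leqnn _) _.
  split=> //; first exact: Inv_code; rewrite ?m15 //; last by lia.
  by rewrite /m1 /run_code /= /upd /= m8 m0.
move=> m2 [e12 [e0 [e19 h2]]].
apply: wp_seq; apply: wp_code => //; set m3 := run_code _ m2.
have m35 : m3 5 = n by rewrite /m3 /run_code /= /upd /= e0 addn0.
have h3 y : 24 <= y -> m3 y = m2 y by apply: run_heap.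
apply: wp_seq; apply: wp_weaken (@copy_codeP m3 _ m35) (leqnn _) _.
  split=> //; rewrite ?m35 // => y hy.
  by rewrite ifN //; lia.
move=> m4 [f19 h4].
have h4' i : i < n -> m4 (OB + i) = P (zig n i).
  by move=> hi; rewrite h4 ?ifN ?h3 ?h2 //; lia.
apply: wp_code => // i hi.
rewrite run_cat run_cat; set m5 := run_code [:: IConst 1 0; _] m4.
have m50 : m5 0 = OB by rewrite /m5 /run_code /= /upd /= f19 addn0.
have h5 y : 24 <= y -> m5 y = m4 y by apply: run_heap.
have E y : run_code (low_code (iota 1 23)) m5 y = if y \in iota 1 23 then m5 (OB + y) else m5 y.
  by apply: low_codeE => //; lia.
move: (run_code (low_code _) m5) E => m6 E; clearbody m5.
rewrite run_cons -[run_code [::] _]/(upd m6 0 (m6 (m6 0))).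
have m60 : m6 0 = OB by rewrite E mem_iota.
rewrite {1}/upd m60; case: eqP => [->|ne].
  rewrite E mem_iota ifN; last lia.
  rewrite h5; last lia.
  by rewrite -h4' ?addn0 //; lia.
rewrite E mem_iota; case: ifP => h; first by rewrite h5 ?h4' //; lia.
rewrite h5; last lia.
rewrite h4; last lia.
rewrite ifT; last lia.
by rewrite h3 ?h2 //; lia.
Qed.

Lemma main_codeP m : m 0 = n ->
  (forall u v, 0 < u < n -> v < n -> m (u * n + v + 1) = W u v) ->
  wp main_code m (fun m' => forall i, i < n ->
    m' i = iter (8 * n) (pass W n) id (zig n i)) (600 * n ^ 5).
Proof.
move=> m0 mW.
apply: (@wp_weaken _ _ _ _ (50 * n + ((8 * n * (60 * n ^ 4 + 3) + 1) + 40 * n)) _ _ _ (fun _ h => h)); last first.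
  have : n ^ 5 = n ^ 4 * n by rewrite expnSr.
  have : n <= n ^ 4 by rewrite -{1}(expn1 n) leq_pexp2l //; lia.
  nia.
apply: wp_seq; apply: wp_weaken (init_codeP m0 mW) (leqnn _) _ => m1 [S1 e1].
apply: wp_seq; apply: wp_weaken (searchP n24 S1 e1) (leqnn _) _ => m2 S2.
exact: finish_codeP.
Qed.

End Phases.

Lemma run_consts l m y : uniq l ->
  run_code [seq IConst i i | i <- l] m y = if y \in l then y else m y.
Proof.
elim: l m => //= i l IH m /andP[il ul]; rewrite IH // inE.
have [->|ne] /= := eqVneq y i; first by rewrite (negPf il) /upd eqxx.
by rewrite upd_ne //; apply/eqP.
Qed.

Lemma tsp_codeP n (w : {set 'I_n} -> nat) : 3 <= n ->
  exists m, exec (tsp_code 0) (700 * n ^ 5) (init_state w) = Some m /\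
    (n < 24 -> forall i, i < n -> m i = i) /\
    (24 <= n -> forall i, i < n ->
       m i = iter (8 * n) (pass (enc_weight w) n) id (zig n i)).
Proof.
move=> n3.
set m0 := Defs.mem (init_state w).
set Q := fun m : mem_t => (n < 24 -> forall i, i < n -> m i = i) /\
    (24 <= n -> forall i, i < n ->
       m i = iter (8 * n) (pass (enc_weight w) n) id (zig n i)).
have e0 : m0 0 = n by [].
suff h : wp tsp_code m0 Q (700 * n ^ 5).
  have [m [t [le_t Qm r]]] := h [::] [::].
  exists m; split=> //; apply: exec_halt le_t.
  by move: r; rewrite cat0s cats0 add0n.
have n5 : 3 ^ 5 <= n ^ 5 by rewrite leq_exp2r.
set T := if n < 24 then 24 else 600 * n ^ 5.
apply: (@wp_weaken _ _ _ _ (2 + (T + 3)) _ _ _ (fun _ h => h)); last first.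
  by move: n5; rewrite /T; case: ifP => _; lia.
apply: wp_seq; apply: wp_code => //; set m1 := run_code _ m0.
have m1E y : y != 1 -> m1 y = m0 y.
  by move=> ne; apply: run_frame; rewrite /= !andbT eq_sym ne.
have m11 : m1 1 = 24 - n by [].
(* The short branch leaves its result in cells [0] to [23]; its closing jump therefore clears cell
   24, which is no output cell when [n < 24]. *)
clearbody m1; apply: (@wp_if 24 1 _ _ _ _ (fun m => n < 24 /\ forall i, i < 24 -> m i = i)).
- move=> nz; have n24 : n < 24 by lia.
  rewrite /T n24; apply: wp_code => //; split=> // i hi.
  by rewrite run_consts ?rev_uniq ?iota_uniq // mem_rev mem_iota hi.
- move=> m [n24 hm]; split; last by lia.
  by move=> _ i hi; rewrite upd_ne; [apply: hm|]; lia.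
move=> z; have n24 : 24 <= n by lia.
rewrite /T ltnNge n24 /=.
apply: wp_weaken (@main_codeP n (enc_weight w) n24 m1 _ _) (leqnn _) _.
- by rewrite m1E.
- move=> u v hu hv; have hc := weight_cell n24 hu hv.
  rewrite m1E; last lia.
  rewrite /m0 /= ifN; last lia.
  rewrite addnK ifT; last lia.
  by rewrite divnMDl ?modnMDl ?divn_small ?modn_small ?addn0 //; lia.
by move=> m hm; split=> //; lia.
Qed.

(** * Locally optimal matchings *)

Section Matching.

Variables (T : finType) (V : {set T}) (bar : T -> T) (g : T -> T -> nat).
Hypothesis barK : involutive bar.
Hypothesis barV : forall x, x \in V -> bar x \in V.
Hypothesis g_sym : forall x y, g x y = g y x.
Hypothesis g_le1 : forall x y, g x y <= 1.
Hypothesis exchange2 : forall a c, a \in V -> c \in V -> c != a -> c != bar a ->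
  g a (bar a) + g c (bar c) <= g a c + g (bar a) (bar c).
Hypothesis exchange3 : forall a b c, a \in V -> b \in V -> c \in V ->
  b != a -> b != bar a -> c != a -> c != bar a -> c != b -> c != bar b ->
  g a (bar a) + g b (bar b) + g c (bar c) <= g a c + g b (bar c) + g (bar a) (bar b).

Let U := [set x in V | g x (bar x) == 1].
Let Z := [set x in V | g x (bar x) == 0].
Let u := #|U|.
Let v := #|Z|.
Let N c := [set a in U | g a c == 0].
Let f c := #|N c|.
(** Of the two numbers of weight-1 edges from [c] and from [bar c] to [U], the smaller one. *)
Let sg c := u - maxn (f c) (f (bar c)).

Let UV x : x \in U -> x \in V /\ g x (bar x) = 1.
Proof. by rewrite inE => /andP[? /eqP]. Qed.

Let ZV x : x \in Z -> x \in V /\ g x (bar x) = 0.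
Proof. by rewrite inE => /andP[? /eqP]. Qed.

Let barU x : (bar x \in U) = (x \in U).
Proof.
rewrite !inE barK g_sym; congr andb; apply/idP/idP => /barV //.
by rewrite barK.
Qed.

Let barZ x : (bar x \in Z) = (x \in Z).
Proof.
rewrite !inE barK g_sym; congr andb; apply/idP/idP => /barV //.
by rewrite barK.
Qed.

Let UZ x y : x \in U -> y \in Z -> x != y.
Proof. by move=> /UV[_ hx] /ZV[_ hy]; apply/eqP => e; move: hx; rewrite e hy. Qed.

Lemma card_UZ : #|V| = u + v.
Proof.
rewrite /u /v -(cardsID U V); congr (_ + _); apply: eq_card => x; rewrite !inE.
  by case: (x \in V).
by case: (x \in V) => //=; have := g_le1 x (bar x); rewrite andbT; case: (g x (bar x)) => [|[]].
Qed.

Lemma sum_bar : \sum_(x in V) g x (bar x) = u.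
Proof.
rewrite /u -sum1_card [RHS](eq_bigl (fun x => (x \in V) && (g x (bar x) == 1))); last first.
  by move=> x; rewrite inE.
rewrite big_mkcondr /=; apply: eq_bigr => x _; have := g_le1 x (bar x).
by case: (g x (bar x)) => [|[]].
Qed.

Lemma sum_V (F : T -> nat) : \sum_(x in V) F x = \sum_(x in U) F x + \sum_(x in Z) F x.
Proof.
rewrite (bigID (mem U)) /=; congr (_ + _); apply: eq_bigl => x; rewrite !inE.
  by case: (x \in V).
by case: (x \in V) => //=; have := g_le1 x (bar x); case: (g x (bar x)) => [|[]].
Qed.

Lemma heavy_clique x y : x \in U -> y \in U -> y != x -> g x y = 1.
Proof.
move=> /UV[xV gx] /UV[yV gy] ne; have [->//|ne'] := eqVneq y (bar x).
have := exchange2 xV yV ne ne'; have := g_le1 x y; have := g_le1 (bar x) (bar y).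
lia.
Qed.

Lemma sum_UU : u * u <= \sum_(x in U) \sum_(y in U) g x y + u.
Proof.
rewrite {2}/u -[X in _ + X]sum1_card -big_split /=.
have -> : u * u = \sum_(x in U) u by rewrite sum_nat_const.
apply: leq_sum => x xU; rewrite (bigD1 x) //=.
suff : u <= 1 + \sum_(y in U | y != x) g x y by lia.
rewrite {1}/u (cardsD1 x) xU leq_add2l -sum1_card.
rewrite (eq_bigl (fun y => (y \in U) && (y != x))); last first.
  by move=> y; rewrite !inE andbC.
by apply: leq_sum => y /andP[yU ne]; rewrite heavy_clique.
Qed.

Lemma cross_sum c : \sum_(a in U) g a c + f c = u.
Proof.
rewrite /f /u -!sum1_card [X in _ + X](eq_bigl (fun a => (a \in U) && (g a c == 0))); last first.
  by move=> a; rewrite inE.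
rewrite big_mkcondr /= -big_split /=; apply: eq_bigr => a _; have := g_le1 a c.
by case: (g a c) => [|[]].
Qed.

(** Otherwise the edges [a c] and [b (bar c)] of weight 0 would improve the matching: by a
    two-exchange if [b = bar a], else by the three-exchange, which trades weight 2 for
    [g (bar a) (bar b) <= 1]. *)
Lemma cross_light a b c : a \in U -> b \in U -> c \in Z -> a != b ->
  1 <= g a c + g b (bar c).
Proof.
move=> aU bU cZ ab; have [[[aV ga] [bV gb]] [cV gc]] := (UV aU, UV bU, ZV cZ).
have ca : c != a by rewrite eq_sym UZ.
have ca' : c != bar a by rewrite eq_sym UZ // barU.
have [->|ba] := eqVneq b (bar a).
  by have := exchange2 aV cV ca ca'; lia.
have cb : c != b by rewrite eq_sym UZ.
have cb' : c != bar b by rewrite eq_sym UZ // barU.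
rewrite eq_sym in ab.
have := exchange3 aV bV cV ab ba ca ca' cb cb'; have := g_le1 (bar a) (bar b); lia.
Qed.

(** If [N c] and [N (bar c)] are both nonempty, every member of one equals every member of the
    other, so both are the same singleton. Otherwise one summand is 0. *)
Lemma light_deg c : c \in Z -> f c + f (bar c) <= (maxn (f c) (f (bar c))).+1.
Proof.
move=> cZ; rewrite /f; have [->|[a aN]] := set_0Vmem (N c).
  by rewrite cards0; lia.
have [->|[b bN]] := set_0Vmem (N (bar c)); first by rewrite cards0; lia.
have h x y : x \in N c -> y \in N (bar c) -> x = y.
  rewrite !inE -!andbA => /and3P[xV xU /eqP hx] /and3P[yV yU /eqP hy]; apply/eqP/negPn/negP => ne.
  have xU' : x \in U by rewrite inE xV.
  have yU' : y \in U by rewrite inE yV.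
  by have := cross_light xU' yU' cZ ne; rewrite hx hy.
have c1 : #|N c| <= 1.
  by apply/card_le1_eqP => x y xN yN; rewrite (h _ _ xN bN) (h _ _ yN bN).
have c2 : #|N (bar c)| <= 1.
  by apply/card_le1_eqP => x y xN yN; rewrite -(h _ _ aN xN) -(h _ _ aN yN).
lia.
Qed.

Lemma reindex_barZ (F : T -> nat) : \sum_(c in Z) F (bar c) = \sum_(c in Z) F c.
Proof.
rewrite [RHS](reindex_inj (inv_inj barK)) /=; apply: eq_bigl => c; exact/esym/barZ.
Qed.

(** Counting every [c] together with [bar c] turns [light_deg] into a bound per matching edge: its
    two ends send weight at least [u + sg c - 1] to [U]. *)
Lemma sum_UZ : u * v + \sum_(c in Z) sg c <= 2 * (\sum_(c in Z) \sum_(a in U) g a c) + v.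
Proof.
rewrite mul2n -addnn -{1}(reindex_barZ (fun c => \sum_(a in U) g a c)).
have -> : u * v = \sum_(c in Z) u by rewrite sum_nat_const mulnC.
rewrite {1}/v -[X in _ <= _ + X]sum1_card -!big_split /=; apply: leq_sum => c cZ.
have := light_deg cZ; have := cross_sum c; have := cross_sum (bar c); rewrite /sg; lia.
Qed.

(** If one of the four edges between the two matching edges has weight 1, the first term suffices.
    Otherwise [f y + f y' <= u] for every choice of ends [y], [y'], and the two slacks add up to at
    least [u]. *)
Lemma light_pair c c' : c \in Z -> c' \in Z -> c' != c -> c' != bar c ->
  u <= u * (g c c' + g c (bar c') + g (bar c) c' + g (bar c) (bar c')) + sg c + sg c'.
Proof.
move=> cZ c'Z ne ne'; set G := (_ + g (bar c) (bar c')).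
case: (posnP G) => [G0|]; last by nia.
have claim y y' : y \in Z -> y' \in Z -> y' != y -> y' != bar y ->
    g (bar y) (bar y') = 0 -> f y + f y' <= u.
  move=> yZ y'Z ny ny' g0; rewrite leqNgt; apply/negP => lt.
  have sub : N y :|: bar @: N y' \subset U.
    rewrite subUset; apply/andP; split; apply/subsetP => a; first by rewrite inE => /andP[].
    by case/imsetP => b; rewrite inE => /andP[bU _] ->; rewrite barU.
  (* Pigeonhole inside [U]: some [a] in [N y] has its partner in [N y']. Then the weight-0 edges
     [y a], [y' (bar a)] and [(bar y) (bar y')] could replace three matching edges of total weight
     1. *)
  have : 0 < #|N y :&: bar @: N y'|.
    have := subset_leq_card sub; have := cardsUI (N y) (bar @: N y').
    rewrite card_imset; last exact: inv_inj barK.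
    by move: lt; rewrite /f /u; lia.
  case/card_gt0P => a; rewrite inE => /andP[].
  rewrite [a \in N y]inE => /andP[aU /eqP gay] /imsetP[b]; rewrite inE => /andP[bU /eqP gb] ab.
  have [[[aV ga] [yV gy]] [y'V gy']] := (UV aU, ZV yZ, ZV y'Z).
  have baU : bar a \in U by rewrite barU.
  have := exchange3 yV y'V aV ny ny' (UZ aU yZ) _ (UZ aU y'Z) _.
  rewrite !UZ ?barZ // => /(_ isT isT).
  rewrite gy gy' ga g0 [g y a]g_sym gay.
  by rewrite ab barK [g y' b]g_sym gb.
have nb x y : (bar x != bar y) = (x != y) by rewrite (inj_eq (inv_inj barK)).
rewrite /G in G0.
have h1 : f c + f c' <= u by apply: claim => //; lia.
have h2 : f c + f (bar c') <= u.
  apply: claim; rewrite ?barZ ?barK // ?nb //; last lia.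
  by rewrite -[c]barK nb.
have h3 : f (bar c) + f c' <= u by apply: claim; rewrite ?barZ ?barK //; lia.
have h4 : f (bar c) + f (bar c') <= u.
  apply: claim; rewrite ?barZ ?barK ?nb //; last lia.
  by rewrite -[c]barK nb.
by rewrite /sg; lia.
Qed.

(** [light_pair] summed over ordered pairs in [Z]. The four terms of [G] have equal sums because
    [bar] permutes [Z]; the excluded cases [d = c] and [d = bar c] cost [2 * u * v]. *)
Lemma sum_ZZ : u * v * v <= 4 * u * (\sum_(c in Z) \sum_(d in Z) g c d)
  + 2 * v * (\sum_(c in Z) sg c) + 2 * u * v.
Proof.
pose G c d := g c d + g c (bar d) + g (bar c) d + g (bar c) (bar d).
have hp c d : c \in Z -> d \in Z ->
    u <= u * G c d + sg c + sg d + u * ((d == c) + (d == bar c)).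
  move=> cZ dZ; have [_|ne] := eqVneq d c; first by nia.
  have [_|ne'] := eqVneq d (bar c); first by nia.
  by have := light_pair cZ dZ ne ne'; rewrite /G; lia.
have eqZ (e : T) : \sum_(d in Z) (d == e : nat) <= 1.
  rewrite -big_mkcondr /= sum1_card.
  apply: leq_trans (_ : #|[set e]| <= 1); last by rewrite cards1.
  by apply: subset_leq_card; apply/subsetP => d; rewrite !inE => /andP[].
have sG : \sum_(c in Z) \sum_(d in Z) G c d = 4 * \sum_(c in Z) \sum_(d in Z) g c d.
  have e1 c : \sum_(d in Z) g c (bar d) = \sum_(d in Z) g c d by rewrite (reindex_barZ (g c)).
  under eq_bigr => c _ do rewrite !big_split /= !e1.
  rewrite !big_split /= !(reindex_barZ (fun c => \sum_(d in Z) g c d)); lia.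
clearbody G.
have -> : u * v * v = \sum_(c in Z) \sum_(d in Z) u.
  by rewrite !sum_nat_const -/v; lia.
have le1 : \sum_(c in Z) \sum_(d in Z) u <= \sum_(c in Z) \sum_(d in Z)
    (u * G c d + sg c + sg d + u * ((d == c) + (d == bar c))).
  by apply: leq_sum => c cZ; apply: leq_sum => d dZ; apply: hp.
apply: leq_trans le1 _.
have step c : \sum_(d in Z) (u * G c d + sg c + sg d + u * ((d == c) + (d == bar c)))
   <= u * (\sum_(d in Z) G c d) + (v * sg c + (\sum_(d in Z) sg d + u * 2)).
  have le2 : u * (\sum_(d in Z) ((d == c) + (d == bar c))) <= u * 2.
    rewrite leq_mul2l big_split /=; apply/orP; right.
    by have := eqZ c; have := eqZ (bar c); lia.
  by rewrite !big_split /= sum_nat_const -/v -!big_distrr /=; lia.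
apply: (@leq_trans (\sum_(c in Z) (u * (\sum_(d in Z) G c d)
   + (v * sg c + (\sum_(d in Z) sg d + u * 2))))); first exact: leq_sum.
rewrite !big_split /= -!big_distrr /= !sum_nat_const sG -/v; lia.
Qed.

(** [X] is the total slack and [E] the weight inside [Z]. The second inequality keeps them from both
    being small; the first then pushes [u] below the average. *)
Lemma matching_defect : exists X E : nat,
  u * (u + v) + X + E <= \sum_(x in V) \sum_(y in V) g x y + (u + v) /\
  u * v * v <= 4 * u * E + 2 * v * X + 2 * u * v.
Proof.
exists (\sum_(c in Z) sg c), (\sum_(c in Z) \sum_(d in Z) g c d).
split; last exact: sum_ZZ.
have -> : \sum_(x in V) \sum_(y in V) g x y = \sum_(x in U) \sum_(y in U) g x y +
   2 * (\sum_(c in Z) \sum_(a in U) g a c) + \sum_(c in Z) \sum_(d in Z) g c d.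
  under eq_bigr => x _ do rewrite sum_V.
  rewrite big_split /= !sum_V [\sum_(x in U) \sum_(y in Z) g x y]exchange_big /=.
  have -> : \sum_(x in Z) \sum_(y in U) g x y = \sum_(c in Z) \sum_(a in U) g a c.
    by apply: eq_bigr => c _; apply: eq_bigr => a _.
  lia.
have := sum_UU; have := sum_UZ; lia.
Qed.

End Matching.

(** * Local optima of the search *)

Lemma sum_local (m n : nat) (L : seq nat) (F F' : nat -> nat) :
  uniq L -> all (fun x => m <= x < n) L ->
  (forall x, m <= x < n -> x \notin L -> F' x = F x) ->
  \sum_(m <= x < n) F' x + \sum_(x <- L) F x = \sum_(m <= x < n) F x + \sum_(x <- L) F' x.
Proof.
move=> uL aL eF.
have split_L (G : nat -> nat) : \sum_(m <= x < n) G x =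
    \sum_(x <- L) G x + \sum_(m <= x < n | x \notin L) G x.
  rewrite (bigID (fun x => x \in L)) /=; congr (_ + _).
  rewrite -big_filter; apply: perm_big; apply: uniq_perm => //.
    by rewrite filter_uniq // iota_uniq.
  move=> x; rewrite mem_filter mem_index_iota andb_idr // => xL.
  exact: (allP aL).
rewrite !split_L.
have -> : \sum_(m <= x < n | x \notin L) F' x = \sum_(m <= x < n | x \notin L) F x.
  by rewrite big_nat_cond [RHS]big_nat_cond; apply: eq_bigr => x /andP[hx nx]; apply: eF.
lia.
Qed.

Lemma sum_delta (m n k : nat) : \sum_(m <= x < n) (x == k : nat) <= 1.
Proof.
rewrite -big_mkcond /= sum1_count.
by apply: leq_trans (leq_b1 (k \in index_iota m n)); rewrite -count_uniq_mem ?iota_uniq.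
Qed.

Lemma sum_inj_le (n : nat) (s : seq nat) (h F : nat -> nat) : uniq s ->
  {in s &, injective h} -> (forall i, i \in s -> h i < n) ->
  \sum_(i <- s) F (h i) <= \sum_(0 <= x < n) F x.
Proof.
move=> us hi hn; rewrite -(big_map h xpredT F).
set L := [seq h i | i <- s].
have uL : uniq L by rewrite map_inj_in_uniq.
have aL : all (fun x => 0 <= x < n) L by apply/allP => x /mapP[i si ->]; rewrite /= hn.
have := @sum_local 0 n L F (fun x => if x \in L then 0 else F x) uL aL
  (fun x _ xL => ifN _ _ xL).
have -> : \sum_(x <- L) (if x \in L then 0 else F x) = 0.
  by rewrite big1_seq // => x /= ->.
lia.
Qed.

Section LocalSearch.

Variables (S : Type) (f : nat -> S -> S) (pot : S -> nat).

Lemma countdown_progress k s : (forall j s, 0 < j <= k -> f j s = s \/ pot (f j s) < pot s) ->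
  (countdown f k s = s /\ forall j, 0 < j <= k -> f j s = s) \/ pot (countdown f k s) < pot s.
Proof.
elim: k s => [|k IH] s hf; first by left; split=> // j; lia.
have hf' : forall j s, 0 < j <= k -> f j s = s \/ pot (f j s) < pot s.
  by move=> j t hj; apply: hf; lia.
have hk : 0 < k.+1 <= k.+1 by lia.
rewrite /=; have [e|lt] := hf k.+1 s hk; last first.
  by right; have [[-> _]|] := IH (f k.+1 s) hf'; lia.
rewrite e; have [[-> h]|lt] := IH s hf'; last by right.
left; split=> // j hj; have [->//|ne] := eqVneq j k.+1.
by apply: h; lia.
Qed.

End LocalSearch.

Definition locally_optimal (W : nat -> nat -> nat) (n : nat) (P : mem_t) : Prop :=
  forall a b c, 0 < a < n.-1 -> 0 < b < n.-1 -> 0 < c < n.-1 ->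
    Phi W n P <= Phi W n (rematch n a b c P).

(** A pass that never improves has tested every move on the same [P], which certifies local
    optimality; any accepted move lowers the potential for good. *)
Lemma pass_progress W n P :
  (pass W n P = P /\ locally_optimal W n P) \/ Phi W n (pass W n P) < Phi W n P.
Proof.
have ht a b c Q : try W n a b c Q = Q \/ Phi W n (try W n a b c Q) < Phi W n Q.
  by rewrite /try; case: ifP => h; [right | left].
have hc a b := @countdown_progress _ (fun c => try W n a b c) (Phi W n) n.-2.
have hb a := @countdown_progress _ (fun b => countdown (fun c => try W n a b c) n.-2) (Phi W n) n.-2.
have [|[e h]|lt] := @countdown_progress _ (fun a => countdown (fun b => countdown (fun c => try W n a b c) n.-2) n.-2)
   (Phi W n) n.-2 P; last by right.
  move=> a Q _; have [|[-> _]|] := hb a Q; [|by left|by right].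
  by move=> b Q' _; have [//|[-> _]|] := hc a b Q'; [left|right].
left; split=> // a b c ha hb' hc'.
have ea := h a ltac:(lia).
have [|[_ h']|] := hb a P; [|move|by rewrite ea ltnn].
  by move=> b' Q' _; have [//|[-> _]|] := hc a b' Q'; [left|right].
have eb := h' b ltac:(lia).
have [//|[_ h'']|] := hc a b P; [move|by rewrite eb ltnn].
have := h'' c ltac:(lia); rewrite /try; case: ifP => [lt e'|]; last by lia.
by rewrite e' ltnn in lt.
Qed.

Lemma iter_pass_optimal W n P k : Phi W n P < k ->
  locally_optimal W n (iter k (pass W n) P).
Proof.
pose fixed Q := pass W n Q = Q /\ locally_optimal W n Q.
have : fixed (iter k (pass W n) P) \/ Phi W n (iter k (pass W n) P) + k <= Phi W n P.
  elim: k => [|k IH]; first by right; rewrite addn0.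
  rewrite iterS; case: IH => [[e h]|le]; first by rewrite e; left; split.
  have [[e h]|lt] := pass_progress W n (iter k (pass W n) P); last by right; lia.
  by rewrite e; left; split.
by case=> [[]//|le lt]; lia.
Qed.

Lemma and8P (b1 b2 b3 b4 b5 b6 b7 b8 : bool) :
  [&& b1, b2, b3, b4, b5, b6, b7 & b8] ->
  [/\ b1, b2, b3, b4 & b5] /\ [/\ b6, b7 & b8].
Proof. by case/and5P=> -> -> -> -> /and4P[-> -> -> ->]. Qed.

(** * Exchange inequalities at a local optimum *)

Section Moves.

Variables (n : nat) (W : nat -> nat -> nat) (P : mem_t).
Hypothesis W_sym : forall i j, W i j = W j i.
Hypothesis W_le1 : forall i j, W i j <= 1.
Hypothesis P_opt : locally_optimal W n P.

Definition rest_sum (Q : mem_t) : nat := \sum_(1 <= x < n) W (Q x) (Q (n - x)).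
Definition pair_sum (Q : mem_t) : nat := \sum_(1 <= x < n) W (Q x) (Q (n.-1 - x)).

Lemma Phi_split Q : Phi W n Q = rest_sum Q + 5 * pair_sum Q.
Proof. by rewrite /Phi /term big_split /= -big_distrr. Qed.

Lemma mv_id a b c z : z != n.-1 - a -> z != c -> z != n.-1 - b -> z != n.-1 - c ->
  rematch n a b c P z = P z.
Proof. by move=> *; rewrite /rematch /swap_at !ifN. Qed.

(** At most four positions change, and each lies in at most two of the ordered pairs
    [(x, n - x)]. *)
Lemma rest_sum_mv a b c : rest_sum (rematch n a b c P) <= rest_sum P + 8.
Proof.
pose D x := (x == n.-1 - a) + (x == c) + (x == n.-1 - b) + (x == n.-1 - c)
  + (x == n - (n.-1 - a)) + (x == n - c) + (x == n - (n.-1 - b)) + (x == n - (n.-1 - c)).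
have le x : 1 <= x < n -> W (rematch n a b c P x) (rematch n a b c P (n - x)) <= W (P x) (P (n - x)) + D x.
  move=> hx; case: (posnP (D x)) => [D0|]; last by have := W_le1 (rematch n a b c P x) (rematch n a b c P (n - x)); lia.
  have aux k : x != n - k -> n - x != k by lia.
  move/eqP: D0; rewrite /D !addn_eq0 !eqb0 -!andbA.
  case/and8P=> -[d1 d2 d3 d4 d5] [d6 d7 d8].
  by rewrite !mv_id ?aux ?leq_addr.
have sD : \sum_(1 <= x < n) D x <= 8.
  rewrite !big_split /=.
  have := sum_delta 1 n (n.-1 - a); have := sum_delta 1 n c.
  have := sum_delta 1 n (n.-1 - b); have := sum_delta 1 n (n.-1 - c).
  have := sum_delta 1 n (n - (n.-1 - a)); have := sum_delta 1 n (n - c).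
  have := sum_delta 1 n (n - (n.-1 - b)); have := sum_delta 1 n (n - (n.-1 - c)).
  lia.
apply: (@leq_trans (rest_sum P + \sum_(1 <= x < n) D x)); last by rewrite leq_add2l.
rewrite -big_split /= /rest_sum big_nat_cond [X in _ <= X]big_nat_cond.
by apply: leq_sum => x /andP[hx _]; apply: le.
Qed.

(** The origin of the factor 5: [pair_sum] counts the edges touched by a move twice, so improving
    the matching by one edge would gain [2 * 5 = 10 > 8]. By integrality the exchange inequalities
    below hold without any error term. *)
Lemma pair_sum_mv a b c : 0 < a < n.-1 -> 0 < b < n.-1 -> 0 < c < n.-1 ->
  5 * pair_sum P <= 5 * pair_sum (rematch n a b c P) + 8.
Proof.
move=> ha hb hc; have := P_opt ha hb hc; have := rest_sum_mv a b c.
by rewrite !Phi_split; lia.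
Qed.

Local Notation g x y := (W (P x) (P y)).
Local Notation "~' x" := (n.-1 - x) (at level 35, right associativity).

Ltac split_and := repeat match goal with
  | H : is_true (_ && _) |- _ => let h1 := fresh in let h2 := fresh in
    move/andP: H => [h1 h2] end.

Ltac neq_sym := first [assumption | rewrite eq_sym; assumption].

Ltac swp_eval := rewrite /rematch /swap_at; repeat (match goal with |- context [?x == ?y] =>
  first [ rewrite (_ : (x == y) = true); [|lia] | rewrite (_ : (x == y) = false); [|lia] ] end);
  rewrite //=.

Lemma rev_neq x y : x < n -> y < n -> x != ~' y -> ~' x != y.
Proof. by lia. Qed.

Lemma rev_neq2 x y : x < n -> y < n -> x != y -> ~' x != ~' y.
Proof. by lia. Qed.

Lemma sub_neq x y : x < n -> x != n - y -> n - x != y.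
Proof. by lia. Qed.

Lemma sub_neqS x y : x < n -> x != y.+1 -> n - x != ~' y.
Proof. by lia. Qed.

Lemma exchange_two a c : 0 < a < n.-1 -> 0 < c < n.-1 ->
  a != ~' a -> c != ~' c -> c != a -> c != ~' a ->
  g a (~' a) + g c (~' c) <= g a (~' c) + g (~' a) c.
Proof.
move=> ha hc.
have [an [a'n [cn c'n]]] : a < n /\ ~' a < n /\ c < n /\ ~' c < n by lia.
have aL : all (fun x => 1 <= x < n) [:: a; ~' a; c; ~' c] by rewrite /=; lia.
have bb x : x < n -> ~' ~' x = x by lia.
move=> aa cc ca ca'; set Q := rematch n a a c P.
have ea : Q a = P a by rewrite /Q; swp_eval.
have ea' : Q (~' a) = P (~' c) by rewrite /Q; swp_eval.
have ec : Q c = P (~' a) by rewrite /Q; swp_eval.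
have ec' : Q (~' c) = P c by rewrite /Q; swp_eval.
have := pair_sum_mv ha ha hc; rewrite -/Q.
have uL : uniq [:: a; ~' a; c; ~' c] by rewrite /= !inE; lia.
have eL x : 1 <= x < n -> x \notin [:: a; ~' a; c; ~' c] -> W (Q x) (Q (~' x)) = g x (~' x).
  move=> /andP[_ hx]; rewrite !inE !negb_or => hL; split_and.
  by rewrite /Q !mv_id ?rev_neq2 ?rev_neq.
have := @sum_local 1 n _ (fun x => g x (~' x)) (fun x => W (Q x) (Q (~' x))) uL aL eL.
rewrite -/(pair_sum P) -/(pair_sum Q) !big_cons !big_nil !bb //.
rewrite ea ea' ec ec'.
rewrite [g (~' a) a]W_sym [g (~' c) c]W_sym [g (~' c) a]W_sym [g c (~' a)]W_sym; lia.
Qed.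

Lemma exchange_three a b c : 0 < a < n.-1 -> 0 < b < n.-1 -> 0 < c < n.-1 ->
  a != ~' a -> b != ~' b -> c != ~' c ->
  b != a -> b != ~' a -> c != a -> c != ~' a -> c != b -> c != ~' b ->
  g a (~' a) + g b (~' b) + g c (~' c) <= g a c + g b (~' c) + g (~' a) (~' b).
Proof.
move=> ha hb hc.
have [an [a'n [bn [b'n [cn c'n]]]]] :
  a < n /\ ~' a < n /\ b < n /\ ~' b < n /\ c < n /\ ~' c < n by lia.
have aL : all (fun x => 1 <= x < n) [:: a; ~' a; b; ~' b; c; ~' c] by rewrite /=; lia.
have bb x : x < n -> ~' ~' x = x by lia.
move=> aa bb' cc ba ba' ca ca' cb cb'; set Q := rematch n a b c P.
have ab' := rev_neq bn an ba'; have a'b' := rev_neq2 bn an ba.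
have ac' := rev_neq cn an ca'; have a'c' := rev_neq2 cn an ca.
have bc' := rev_neq cn bn cb'; have b'c' := rev_neq2 cn bn cb.
have uL : uniq [:: a; ~' a; b; ~' b; c; ~' c].
  by rewrite /= !inE !negb_or; do ![apply/andP; split] => //; neq_sym.
have [ea [ea' [eb [eb' [ec ec']]]]] : Q a = P a /\ Q (~' a) = P c /\ Q b = P b /\
    Q (~' b) = P (~' c) /\ Q c = P (~' a) /\ Q (~' c) = P (~' b).
  rewrite /Q /rematch /swap_at !eqxx.
  by do ![split]; repeat (rewrite ifN; [|neq_sym]).
have := pair_sum_mv ha hb hc; rewrite -/Q.
have eL x : 1 <= x < n -> x \notin [:: a; ~' a; b; ~' b; c; ~' c] -> W (Q x) (Q (~' x)) = g x (~' x).
  move=> /andP[_ hx]; rewrite !inE !negb_or => hL; split_and.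
  by rewrite /Q !mv_id ?rev_neq2 ?rev_neq.
have := @sum_local 1 n _ (fun x => g x (~' x)) (fun x => W (Q x) (Q (~' x))) uL aL eL.
rewrite -/(pair_sum P) -/(pair_sum Q) !big_cons !big_nil !bb //.
rewrite ea ea' eb eb' ec ec'.
rewrite [g (~' a) a]W_sym [g (~' b) b]W_sym [g (~' c) c]W_sym.
rewrite [g c a]W_sym [g (~' c) b]W_sym [g (~' b) (~' a)]W_sym.
by clear; lia.
Qed.

(* Exchanging two matched pairs leaves the matching unchanged, so it cannot
   decrease the weight of the remaining edges. *)
Lemma exchange_rest a c : 0 < a < n.-1 -> 0 < c < n.-1 ->
  uniq [:: a; ~' a; c; ~' c; n - a; a.+1; n - c; c.+1] ->
  g a (n - a) + g (~' a) a.+1 + (g c (n - c) + g (~' c) c.+1) <=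
  g (n - a) c + g (~' c) a.+1 + g a (n - c) + g (~' a) c.+1.
Proof.
move=> ha hc.
have [an [a'n [cn c'n]]] : a < n /\ ~' a < n /\ c < n /\ ~' c < n by lia.
have aL' : all (fun x => 1 <= x < n) [:: a; ~' a; c; ~' c] by rewrite /=; lia.
have aL : all (fun x => 1 <= x < n) [:: a; ~' a; c; ~' c; n - a; a.+1; n - c; c.+1].
  by rewrite /=; lia.
have bb x : x < n -> ~' ~' x = x by lia.
have [e1 [e2 [e3 [e4 [e5 e6]]]]] : n - (n - a) = a /\ n - (n - c) = c /\
  n - ~' a = a.+1 /\ n - ~' c = c.+1 /\ n - a.+1 = ~' a /\ n - c.+1 = ~' c by lia.
have ha' : 0 < ~' a < n.-1 by lia.
have hc' : 0 < ~' c < n.-1 by lia.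
have := P_opt ha ha' hc'; set Q := rematch n a (~' a) (~' c) P => opt uL.
have uL' : uniq [:: a; ~' a; c; ~' c].
  by have := uL; rewrite -[X in uniq X]/([:: a; ~' a; c; ~' c] ++ [:: n - a; a.+1; n - c; c.+1]) cat_uniq => /and3P[].
have := uL; rewrite /= !inE !negb_or => hU; split_and.
have [ea [ea' [ec ec']]] : Q a = P c /\ Q (~' a) = P (~' c) /\ Q c = P a /\ Q (~' c) = P (~' a).
  rewrite /Q /rematch /swap_at !bb // !eqxx.
  by do ![split]; repeat (rewrite ifN; [|neq_sym]).
have Qid x : x \notin [:: a; ~' a; c; ~' c] -> Q x = P x.
  by rewrite !inE !negb_or => hx; split_and; rewrite /Q mv_id ?bb.
have ePQ : pair_sum Q = pair_sum P.
  have eL x : 1 <= x < n -> x \notin [:: a; ~' a; c; ~' c] -> W (Q x) (Q (~' x)) = g x (~' x).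
    move=> /andP[_ hx] hL; rewrite !Qid //; move: hL; rewrite !inE !negb_or => hL; split_and.
    by rewrite !rev_neq2 ?rev_neq.
  have := @sum_local 1 n _ (fun x => g x (~' x)) (fun x => W (Q x) (Q (~' x))) uL' aL' eL.
  rewrite -/(pair_sum P) -/(pair_sum Q) !big_cons !big_nil !bb // ea ea' ec ec'.
  by clear; lia.
have eL x : 1 <= x < n -> x \notin [:: a; ~' a; c; ~' c; n - a; a.+1; n - c; c.+1] ->
    W (Q x) (Q (n - x)) = g x (n - x).
  move=> /andP[_ hx]; rewrite !inE !negb_or => hL; split_and.
  rewrite !Qid // !inE !negb_or.
    by rewrite !sub_neqS ?sub_neq.
  by do ![apply/andP; split].
have := @sum_local 1 n _ (fun x => g x (n - x)) (fun x => W (Q x) (Q (n - x))) uL aL eL.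
rewrite -/(rest_sum P) -/(rest_sum Q) !big_cons !big_nil.
have Qid' x : x != a -> x != ~' a -> x != c -> x != ~' c -> Q x = P x.
  by move=> h1 h2 h3 h4; apply: Qid; rewrite !inE !negb_or h1 h2 h3 h4.
have f1 : Q (n - a) = P (n - a) by apply: Qid'; neq_sym.
have f2 : Q (n - c) = P (n - c) by apply: Qid'; neq_sym.
have f3 : Q a.+1 = P a.+1 by apply: Qid'; neq_sym.
have f4 : Q c.+1 = P c.+1 by apply: Qid'; neq_sym.
rewrite e1 e2 e3 e4 e5 e6 ea ea' ec ec' f1 f2 f3 f4.
move: opt; rewrite !Phi_split ePQ leq_add2r.
rewrite [g c (n - a)]W_sym [g a.+1 _]W_sym [g (n - c) _]W_sym [g c.+1 (~' a)]W_sym.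
rewrite [g (n - a) a]W_sym [g a.+1 _]W_sym [g (n - c) _]W_sym [g c.+1 (~' c)]W_sym.
by clear; lia.
Qed.

Definition pos_total : nat := \sum_(0 <= x < n) \sum_(0 <= y < n) g x y.

(** The first six terms place [a] or [c] near the middle, the others place [c] within one of [a] or
    of its mirror image. If all vanish, the eight positions in [exchange_rest] are distinct. Each
    term sums to at most [n] over all pairs. *)
Definition clash a c : nat :=
  (a == (n - 2)./2) + (a == n.-1./2) + (a == n./2)
  + (c == (n - 2)./2) + (c == n.-1./2) + (c == n./2)
  + (c == a) + (c == a.-1) + (c == a.+1) + (c == n.-1 - a) + (c == n - a) + (c == n - 2 - a).

Lemma rest_step a c : 0 < a < n.-1 -> 0 < c < n.-1 ->
  g a (n - a) + g (~' a) a.+1 + (g c (n - c) + g (~' c) c.+1) <=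
  g (n - a) c + g (~' c) a.+1 + g a (n - c) + g (~' a) c.+1 + 4 * clash a c.
Proof.
move=> ha hc; case: (posnP (clash a c)) => [e0|].
  rewrite e0 muln0 addn0; apply: exchange_rest => //.
  move/eqP: e0; rewrite /clash !addn_eq0 !eqb0 -!andbA => hU.
  have hm : 0 < a < n.-1 /\ 0 < c < n.-1 by [].
  clear ha hc; split_and; rewrite /= !inE !negb_or.
  by do ![apply/andP; split] => //; apply/negP => /eqP e;
    match goal with H : is_true (_ != _) |- _ => move: H e hm; clear; lia end.
have := W_le1 (P a) (P (n - a)); have := W_le1 (P (~' a)) (P a.+1).
have := W_le1 (P c) (P (n - c)); have := W_le1 (P (~' c)) (P c.+1); lia.
Qed.

Lemma double_sum_le (s : seq nat) (h k : nat -> nat) : uniq s ->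
  {in s &, injective h} -> (forall i, i \in s -> h i < n) ->
  {in s &, injective k} -> (forall i, i \in s -> k i < n) ->
  \sum_(a <- s) \sum_(c <- s) g (h a) (k c) <= pos_total.
Proof.
move=> us hi hn ki kn.
apply: leq_trans (sum_inj_le (fun x => \sum_(0 <= y < n) g x y) us hi hn).
by apply: leq_sum => a _; apply: (sum_inj_le (fun y => g (h a) y)).
Qed.

Lemma sum_clash : \sum_(1 <= a < n.-1) \sum_(1 <= c < n.-1) clash a c <= 12 * n.
Proof.
have cst k : \sum_(1 <= a < n.-1) \sum_(1 <= c < n.-1) (a == k : nat) <= n.
  rewrite exchange_big /=; apply: (@leq_trans (\sum_(1 <= c < n.-1) 1)).
    by apply: leq_sum => c _; apply: sum_delta.
  by rewrite sum_nat_const_nat; lia.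
have var (h : nat -> nat) : \sum_(1 <= a < n.-1) \sum_(1 <= c < n.-1) (c == h a : nat) <= n.
  apply: (@leq_trans (\sum_(1 <= a < n.-1) 1)).
    by apply: leq_sum => a _; apply: sum_delta.
  by rewrite sum_nat_const_nat; lia.
rewrite /clash; under eq_bigr => a _ do rewrite !big_split /=.
rewrite !big_split /=.
have := cst (n - 2)./2; have := cst n.-1./2; have := cst n./2.
have := var (fun=> (n - 2)./2); have := var (fun=> n.-1./2); have := var (fun=> n./2).
have := var id; have := var predn; have := var succn; have := var (fun a => n.-1 - a).
have := var (fun a => n - a); have := var (fun a => n - 2 - a).
lia.
Qed.

(** Summing [rest_step] over all [a] and [c] gives [4 * (n - 2) * A] on the left, and each of the
    four weights on the right sums to at most [pos_total]. Clashes contribute [12 * n], and the term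
    of [rest_sum] missing in [A] at most another [n]. *)
Lemma rest_bound : 2 < n -> (n - 2) * rest_sum P <= pos_total + 13 * n.
Proof.
move=> n2; set A := \sum_(1 <= a < n.-1) g a (n - a).
have rA : rest_sum P <= A + 1.
  have -> : rest_sum P = A + g n.-1 (n - n.-1); last by rewrite leq_add2l W_le1.
  have := @big_nat_recr _ 0 addn n.-1 1 (fun x => g x (n - x)).
  by rewrite prednK; [apply; lia | lia].
have A' : \sum_(1 <= a < n.-1) g (~' a) a.+1 = A.
  rewrite /A big_nat_rev /= big_nat_cond [RHS]big_nat_cond.
  apply: eq_bigr => a /andP[ha _]; congr (W (P _) (P _)); lia.
pose s := index_iota 1 n.-1.
have us : uniq s by apply: iota_uniq.
have sP i : i \in s -> 0 < i < n.-1 by rewrite mem_index_iota.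
have le : \sum_(a <- s) \sum_(c <- s) (g a (n - a) + g (~' a) a.+1 + (g c (n - c) + g (~' c) c.+1)) <=
   \sum_(a <- s) \sum_(c <- s) (g (n - a) c + g (~' c) a.+1 + g a (n - c) + g (~' a) c.+1 + 4 * clash a c).
  rewrite big_seq [X in _ <= X]big_seq; apply: leq_sum => a /sP ha.
  rewrite big_seq [X in _ <= X]big_seq; apply: leq_sum => c /sP hc.
  exact: rest_step.
have L : \sum_(a <- s) \sum_(c <- s) (g a (n - a) + g (~' a) a.+1 + (g c (n - c) + g (~' c) c.+1)) = 4 * ((n - 2) * A).
  under eq_bigr => a _ do rewrite big_split /= sum_nat_const_nat !big_split /= A' -/A.
  rewrite !big_split /= sum_nat_const_nat -big_distrr /= big_split /= A' -/A; lia.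
have dI := @double_sum_le s.
have R1 : \sum_(a <- s) \sum_(c <- s) g (n - a) c <= pos_total.
  by apply: dI => // [i j /sP hi /sP hj|i /sP hi|i /sP hi]; lia.
have R2 : \sum_(a <- s) \sum_(c <- s) g (~' c) a.+1 <= pos_total.
  rewrite exchange_big /=.
  by apply: (dI (fun c => ~' c) succn) => // [i j /sP hi /sP hj|i /sP hi|i j /sP hi /sP hj|i /sP hi]; lia.
have R3 : \sum_(a <- s) \sum_(c <- s) g a (n - c) <= pos_total.
  by apply: dI => // [i /sP hi|i j /sP hi /sP hj|i /sP hi]; lia.
have R4 : \sum_(a <- s) \sum_(c <- s) g (~' a) c.+1 <= pos_total.
  by apply: dI => // [i j /sP hi /sP hj|i /sP hi|i j /sP hi /sP hj|i /sP hi]; lia.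
move: le; rewrite L; under [X in _ <= X]eq_bigr => a _ do rewrite 4!big_split /= -big_distrr /=.
rewrite 4!big_split /= -big_distrr /=.
have := sum_clash; rewrite -/s.
have : (n - 2) * rest_sum P <= (n - 2) * A + n.
  by apply: leq_trans (leq_mul (leqnn _) rA) _; lia.
lia.
Qed.

End Moves.

Lemma perm_eq_inj_iota n (h : nat -> nat) : (forall i, i < n -> h i < n) ->
  (forall i j, i < n -> j < n -> h i = h j -> i = j) ->
  perm_eq [seq h i | i <- iota 0 n] (iota 0 n).
Proof.
move=> hn hi.
have us : uniq [seq h i | i <- iota 0 n].
  rewrite map_inj_in_uniq ?iota_uniq // => i j.
  by rewrite !mem_iota /= => h1 h2; apply: hi.
apply: uniq_perm => //; first exact: iota_uniq.
have sub : {subset [seq h i | i <- iota 0 n] <= iota 0 n}.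
  by move=> x /mapP[i]; rewrite !mem_iota /= => h1 ->; rewrite hn.
by case: (uniq_min_size us sub); rewrite ?size_map.
Qed.

Lemma sum_perm_iota n (h F : nat -> nat) : (forall i, i < n -> h i < n) ->
  (forall i j, i < n -> j < n -> h i = h j -> i = j) ->
  \sum_(0 <= x < n) F (h x) = \sum_(0 <= x < n) F x.
Proof.
move=> hn hi; rewrite /index_iota subn0 -(big_map h xpredT F).
by apply: perm_big; apply: perm_eq_inj_iota.
Qed.

Lemma zig_lt n i : i < n -> zig n i < n.
Proof. by rewrite /zig; case: ifP; lia. Qed.

Lemma zig_inj n i j : i < n -> j < n -> zig n i = zig n j -> i = j.
Proof. by rewrite /zig; case: ifP; case: ifP; lia. Qed.

(** * Total weight and weight of the output cycle *)

Section Weight.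

Variables (n : nat) (w : {set 'I_n} -> nat).
Local Notation W := (enc_weight w).

Lemma enc_ord (i j : 'I_n) : W i j = if i == j then 0 else w [set i; j].
Proof. by rewrite /enc_weight !valK. Qed.

Lemma enc_sym i j : W i j = W j i.
Proof.
rewrite /enc_weight; case: insub => [i'|]; case: insub => [j'|] //.
by rewrite eq_sym setUC.
Qed.

Lemma enc_diag i : W i i = 0.
Proof. by rewrite /enc_weight; case: insub => [i'|] //; rewrite eqxx. Qed.

Lemma enc_le1 : zero_one w -> forall i j, W i j <= 1.
Proof.
move=> zo i j; rewrite /enc_weight; case: insub => [i'|] //; case: insub => [j'|] //.
by case: eqVneq => // ne; apply: zo; rewrite cards2 ne.
Qed.

Lemma sum_ord_pairs : \sum_(i : 'I_n) \sum_(j : 'I_n) W i j = 2 * wt w (Kn_edges n).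
Proof.
rewrite pair_big /=.
rewrite (bigID (fun p : 'I_n * 'I_n => p.1 != p.2)) /= [X in _ + X]big1 ?addn0; last first.
  by move=> [i j] /= /negPn/eqP->; apply: enc_diag.
rewrite (partition_big (fun p : 'I_n * 'I_n => [set p.1; p.2]) (fun e => e \in Kn_edges n)) /=; last first.
  by move=> [i j] /= ne; rewrite inE cards2 ne.
rewrite /wt big_distrr /=; apply: eq_bigr => e.
rewrite inE => /cards2P[a [b [ab ->]]].
rewrite (eq_bigl (fun p => (p == (a, b)) || (p == (b, a)))); last first.
  move=> [i j] /=; rewrite !xpair_eqE.
  apply/andP/orP => [[ne /eqP e2]|].
    have := set21 i j; have := set22 i j; rewrite e2 !inE.
    move=> /orP[]/eqP ej /orP[]/eqP ei; rewrite ei ej ?eqxx ?orbT in ne *; by [|left|right].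
  case=> /andP[/eqP-> /eqP->]; first by rewrite ab eqxx.
  by rewrite eq_sym ab setUC eqxx.
rewrite (bigD1 (a, b)) /=; last by rewrite eqxx.
rewrite (bigD1 (b, a)) /=; last by rewrite eqxx orbT xpair_eqE /= eq_sym (negPf ab).
rewrite big1 => [|p /andP[/andP[/orP[]/eqP->]]]; last 2 first.
- by rewrite eqxx.
- by rewrite eqxx.
rewrite !enc_ord [b == a]eq_sym (negPf ab) [[set b; a]]setUC addn0.
by rewrite addnn mul2n.
Qed.

Lemma totalE (P : mem_t) : goodP n P -> pos_total n W P = 2 * wt w (Kn_edges n).
Proof.
move=> [_ Pn Pi]; rewrite -sum_ord_pairs /pos_total.
rewrite (sum_perm_iota (fun x => \sum_(0 <= y < n) W x (P y)) Pn Pi) big_mkord.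
apply: eq_bigr => i _.
by rewrite (sum_perm_iota (fun y => W i y) Pn Pi) big_mkord.
Qed.

(** Every edge of the zigzag path is seen from both ends. From position [x] its neighbours are
    [n - x] and [n.-1 - x], in an order fixed by parity. At either end of the path the missing
    neighbour is read as the position itself and costs [W x x = 0]; this is why [r 0] is set to
    [0]. *)
Lemma zig_sum (P : mem_t) : 0 < n ->
  2 * (\sum_(0 <= i < n.-1) W (P (zig n i)) (P (zig n i.+1))) =
  rest_sum n W P + (W (P 0) (P n.-1) + pair_sum n W P).
Proof.
move=> n0; pose g x y := W (P x) (P y); pose q i := g (zig n i) (zig n i.+1).
pose r x := if x == 0 then 0 else n - x.
have -> : rest_sum n W P = \sum_(0 <= i < n) g (zig n i) (r (zig n i)).
  rewrite (sum_perm_iota (fun x => g x (r x)) (@zig_lt n) (@zig_inj n)) big_ltn // /g enc_diag.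
  rewrite add0n /rest_sum big_nat_cond [RHS]big_nat_cond.
  by apply: eq_bigr => x /andP[hx _]; rewrite /r ifN //; lia.
have -> : W (P 0) (P n.-1) + pair_sum n W P = \sum_(0 <= i < n) g (zig n i) (n.-1 - zig n i).
  by rewrite (sum_perm_iota (fun x => g x (n.-1 - x)) (@zig_lt n) (@zig_inj n)) big_ltn // subn0.
have eA : \sum_(0 <= i < n) (if i.+1 < n then q i else 0) = \sum_(0 <= i < n.-1) q i.
  rewrite -(@prednK n) // big_nat_recr //= prednK // ltnn addn0.
  rewrite big_nat_cond [RHS]big_nat_cond; apply: eq_bigr => i /andP[hi _].
  by rewrite ifT //; lia.
have eB : \sum_(0 <= i < n) (if 0 < i then q i.-1 else 0) = \sum_(0 <= i < n.-1) q i.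
  by rewrite -(@prednK n) // big_nat_recl //= add0n.
rewrite mul2n -addnn -{1}eA -eB -!big_split /= big_nat_cond [RHS]big_nat_cond.
apply: eq_bigr => i /andP[/andP[_ hi] _]; rewrite /q /g.
have sub x : W x x = 0 := enc_diag x.
have [oi|ei] := boolP (odd i).
  have -> : 0 < i by lia.
  have -> : n.-1 - zig n i = zig n i.-1 by rewrite /zig oi ifN; lia.
  rewrite prednK; last lia.
  rewrite [W (P (zig n i.-1)) _]enc_sym; congr (_ + _).
  case: ifP => h.
    have -> : zig n i.+1 = i.+1./2 by rewrite /zig ifN //; lia.
    by congr (W _ (P _)); rewrite /zig /r oi ifN; lia.
  by rewrite (_ : r (zig n i) = zig n i) ?sub // /zig /r oi ifN; lia.
rewrite addnC; congr (_ + _).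
  case: ifP => h; last by rewrite (_ : i = 0) ?sub //; lia.
  rewrite prednK // enc_sym; congr (W _ (P _)).
  have -> : zig n i.-1 = n.-1 - i.-1./2 by rewrite /zig ifT //; lia.
  by rewrite /zig /r (negPf ei) ifN; lia.
case: ifP => h.
  have -> : zig n i.+1 = n.-1 - i.+1./2 by rewrite /zig ifT //; lia.
  by congr (W _ (P _)); rewrite /zig (negPf ei); lia.
by rewrite (_ : n.-1 - zig n i = zig n i) ?sub // /zig (negPf ei); lia.
Qed.

Lemma leq_sum_imset (I J : finType) (A : {pred I}) (h : I -> J) (F : J -> nat) :
  \sum_(e in h @: A) F e <= \sum_(i in A) F (h i).
Proof.
rewrite (partition_big_imset h) /=; apply: leq_sum => e /imsetP[i iA ->].
by rewrite (bigD1 i) ?iA ?eqxx //= leq_addr.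
Qed.

(** An upper bound is all that is wanted, and it spares showing that the [n] edges are distinct. *)
Lemma output_weight (m : mem_t) : 1 < n -> (forall i, i < n -> m i < n) ->
  (forall i j, i < n -> j < n -> m i = m j -> i = j) ->
  wt w (output_cycle n m) <= \sum_(0 <= i < n.-1) W (m i) (m i.+1) + W (m n.-1) (m 0).
Proof.
move=> n1 mn mi; have n0 : 0 < n by lia.
apply: leq_trans (leq_sum_imset _ _ _) _.
have -> : \sum_(0 <= i < n.-1) W (m i) (m i.+1) + W (m n.-1) (m 0)
   = \sum_(0 <= i < n) W (m i) (m (i.+1 %% n)).
  have := @big_nat_recr _ 0 addn n.-1 0 (fun i => W (m i) (m (i.+1 %% n))).
  rewrite prednK // modnn => -> //; congr (_ + _).
  rewrite big_nat_cond [RHS]big_nat_cond; apply: eq_bigr => i /andP[hi _].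
  by rewrite modn_small //; lia.
rewrite big_mkord; apply: leq_sum => i _.
have hi := ltn_ord i; have hj : i.+1 %% n < n by rewrite ltn_mod.
rewrite /enc_weight !insubT ?mn // => h1 h2 /=.
rewrite ifN; last first.
  apply/eqP => /(congr1 val) /= /mi e; have := e hi hj.
  have [h|h] := ltnP i.+1 n; first by rewrite modn_small //; lia.
  by rewrite (_ : i.+1 = n) ?modnn; lia.
rewrite (_ : [set x | _] = [set Sub (m i) h2; Sub (m (i.+1 %% n)) h1]) //.
by apply/setP => x; rewrite !inE -!val_eqE.
Qed.

End Weight.

Lemma rev_ordE n (x : 'I_n) : rev_ord x = n.-1 - x :> nat.
Proof. by rewrite /=; lia. Qed.

Lemma local_opt_defect n (W : nat -> nat -> nat) (P : mem_t) :
  (forall i j, W i j = W j i) -> (forall i, W i i = 0) -> (forall i j, W i j <= 1) ->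
  locally_optimal W n P -> 2 < n ->
  exists u v X E : nat,
  [/\ u + v <= n <= u + v + 3, pair_sum n W P <= u + 1,
      u * (u + v) + X + E <= pos_total n W P + (u + v) &
      u * v * v <= 4 * u * E + 2 * v * X + 2 * u * v].
Proof.
move=> W_sym W_diag W_le1 opt n2.
(* Positions [0] and [n.-1] never move, and for odd [n] the middle position is its own partner.
   Dropping them accounts for the 3 in [n <= u + v + 3]. *)
pose V := [set x : 'I_n | (0 < x < n.-1) && (x != n.-1 - x :> nat)].
pose g (x y : 'I_n) := W (P x) (P y).
have VP x : x \in V -> 0 < x < n.-1 /\ x != n.-1 - x :> nat by rewrite inE => /andP[].
have barK : involutive (@rev_ord n) := @rev_ordK n.
have barV x : x \in V -> rev_ord x \in V.
  by rewrite !inE rev_ordE => /andP[h1 h2]; apply/andP; split; lia.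
have neq (x y : 'I_n) : (x != y) = (x != y :> nat) by [].
have neqr (x y : 'I_n) : (x != rev_ord y) = (x != n.-1 - y :> nat).
  by rewrite neq rev_ordE.
have ex2 a c : a \in V -> c \in V -> c != a -> c != rev_ord a ->
  g a (rev_ord a) + g c (rev_ord c) <= g a c + g (rev_ord a) (rev_ord c).
  move=> aV cV; have [[ha aa] [hc cc]] := (VP _ aV, VP _ cV).
  have [[hc' cc'] an] := (VP _ (barV _ cV), ltn_ord a).
  rewrite neqr neq => ca ca'; move: hc' cc'; rewrite rev_ordE => hc' cc'.
  have cn := ltn_ord c.
  (* Applied to [a] and the partner of [c], which converts {a, c'}, {a', c} into {a, c}, {a',
     c'}. *)
  have := exchange_two W_sym W_le1 opt ha hc' aa cc' (rev_neq cn an ca') (rev_neq2 cn an ca).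
  by rewrite /g !rev_ordE subKn 1?[W (P (n.-1 - c)) (P c)]W_sym //; lia.
have ex3 a b c : a \in V -> b \in V -> c \in V ->
  b != a -> b != rev_ord a -> c != a -> c != rev_ord a -> c != b -> c != rev_ord b ->
  g a (rev_ord a) + g b (rev_ord b) + g c (rev_ord c)
    <= g a c + g b (rev_ord c) + g (rev_ord a) (rev_ord b).
  move=> aV bV cV; have [[[ha aa] [hb bb]] [hc cc]] := (VP _ aV, VP _ bV, VP _ cV).
  rewrite !neqr !neq => h1 h2 h3 h4 h5 h6.
  by have := exchange_three W_sym W_le1 opt ha hb hc aa bb cc h1 h2 h3 h4 h5 h6; rewrite /g !rev_ordE.
have g_sym x y : g x y = g y x by rewrite /g W_sym.
have g_le1 x y : g x y <= 1 by apply: W_le1.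
have := matching_defect barK barV g_sym g_le1 ex2 ex3.
have := @card_UZ _ V (@rev_ord n) g g_le1; have := @sum_bar _ V (@rev_ord n) g g_le1.
set u := #|[set x in V | g x (rev_ord x) == 1]|; set v := #|[set x in V | g x (rev_ord x) == 0]|.
move=> su cV [X [E [h1 h2]]]; exists u, v, X, E; split=> //.
- rewrite -cV; apply/andP; split; first by rewrite -[X in _ <= X]card_ord max_card.
  have le : \sum_(x < n) 1 <= \sum_(x < n) ((x \in V) + (x == 0 :> nat) + (x == n.-1 :> nat) + (x == n.-1./2 :> nat)).
    by apply: leq_sum => x _; rewrite inE; have := ltn_ord x; lia.
  move: le; rewrite !big_split /= sum1_card card_ord.
  have -> : \sum_(x < n) (x \in V : nat) = #|V| by rewrite -big_mkcond /= sum1_card.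
  move=> le; apply: leq_trans le _; rewrite -!addnA leq_add2l -[3]/(1 + (1 + 1)).
  have := sum_delta 0 n 0; have := sum_delta 0 n n.-1; have := sum_delta 0 n n.-1./2.
  by rewrite !big_mkord => d2 d1 d0; apply: leq_add d0 (leq_add d1 d2).
- rewrite -su big_mkcond /=.
  have := sum_delta 0 n n.-1; rewrite big_mkord => sd.
  apply: (@leq_trans (\sum_(x < n) ((if x \in V then g x (rev_ord x) else 0) + (x == n.-1 :> nat)))); last first.
    by rewrite big_split /= leq_add2l.
  apply: (@leq_trans (\sum_(0 <= x < n) (if x == 0 then 0 else W (P x) (P (n.-1 - x))))).
    rewrite [X in _ <= X]big_ltn; last lia.
    rewrite add0n /pair_sum big_nat_cond [X in _ <= X]big_nat_cond; apply: leq_sum => x /andP[hx _].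
    by rewrite ifN //; lia.
  rewrite big_mkord; apply: leq_sum => x _; rewrite /g rev_ordE inE.
  case: eqP => // x0; case: ifP => [_|h]; first exact: leq_addr.
  have := W_le1 (P x) (P (n.-1 - x)); have [->|ne] := eqVneq (x : nat) n.-1; first by lia.
  have -> : n.-1 - x = x by have := ltn_ord x; lia.
  by rewrite W_diag.
apply: leq_trans h1 _; rewrite leq_add2r /pos_total big_mkord big_mkcond /=.
apply: leq_sum => x _; case: ifP => // _; rewrite big_mkord big_mkcond /=.
by apply: leq_sum => y _; case: ifP.
Qed.

Lemma search_weight n (w : {set 'I_n} -> nat) (P : mem_t) (m : mem_t) :
  zero_one w -> 2 < n -> goodP n P -> locally_optimal (enc_weight w) n P ->
  (forall i, i < n -> m i = P (zig n i)) ->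
  exists u v X E r : nat,
  [/\ u + v <= n <= u + v + 3,
      u * (u + v) + X + E <= 2 * wt w (Kn_edges n) + (u + v),
      u * v * v <= 4 * u * E + 2 * v * X + 2 * u * v,
      (n - 2) * r <= 2 * wt w (Kn_edges n) + 13 * n &
      2 * wt w (output_cycle n m) <= r + u + 4].
Proof.
move=> zo n2 gP opt mE; have W1 := enc_le1 zo.
have [u [v [X [E [uv pu h1 h2]]]]] :=
  local_opt_defect (enc_sym w) (enc_diag w) W1 opt n2.
exists u, v, X, E, (rest_sum n (enc_weight w) P).
rewrite -(totalE w gP); split=> //.
  exact: (rest_bound (enc_sym w) W1 opt n2).
have [P0 Pn Pi] := gP.
have mn i : i < n -> m i < n by move=> hi; rewrite mE //; apply/Pn/zig_lt.
have mi i j : i < n -> j < n -> m i = m j -> i = j.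
  move=> hi hj; rewrite !mE // => /Pi; rewrite !zig_lt // => /(_ isT isT); exact: zig_inj.
have := output_weight w (ltac:(lia) : 1 < n) mn mi.
have -> : \sum_(0 <= i < n.-1) enc_weight w (m i) (m i.+1) =
   \sum_(0 <= i < n.-1) enc_weight w (P (zig n i)) (P (zig n i.+1)).
  rewrite big_nat_cond [RHS]big_nat_cond; apply: eq_bigr => i /andP[hi _].
  by rewrite !mE //; lia.
have := zig_sum w P (ltac:(lia) : 0 < n).
have := W1 (m n.-1) (m 0); have := W1 (P 0) (P n.-1); lia.
Qed.

Lemma INR_leq a b : a <= b -> Rle (INR a) (INR b).
Proof. by move=> h; apply: le_INR; apply/leP. Qed.

Lemma INR_addn a b : INR (a + b) = Rplus (INR a) (INR b).
Proof. by rewrite -plusE plus_INR. Qed.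

Lemma INR_muln a b : INR (a * b) = Rmult (INR a) (INR b).
Proof. by rewrite -multE mult_INR. Qed.

Lemma double_bin2 n : 2 * 'C(n, 2) = n * n.-1.
Proof. by rewrite mulnC -[2 in X in X = _]/(2`!) bin_ffact ffactnS ffactn1. Qed.

(** * From the counting inequalities to the gap below the mean *)

Section RealBounds.
Local Open Scope R_scope.

(** For [v <= 2 * u] the trade-off yields [v^2 <= 4 (X + E) + 2 v], while [v >= eta N - 7]. For
    [v > 2 * u] it yields [u v <= 2 (X + E) + 2 u] with [v >= 2 (N - 3) / 3], hence even
    [u <= 3/4 d N + 9]. Both cases leave room for [eta^2 N / 4]; the constant 4/25 is what the
    exponent [eta^4 n / 10^4] requires. *)
Lemma defect_real (eta d N u v X E : R) : 0 < eta -> eta < 1 / 2 -> eta <= d -> d <= 1 - eta ->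
  24 <= N -> 0 <= u -> 0 <= v -> 0 <= X -> 0 <= E -> u + v <= N -> N <= u + v + 3 ->
  u * (u + v) + X + E <= d * (N * (N - 1)) + (u + v) ->
  u * v * v <= 4 * u * E + 2 * v * X + 2 * u * v ->
  u <= d * N - 4 / 25 * eta ^ 2 * N + 9.
Proof.
move=> e0 e1 d1 d2 N24 u0 v0 X0 E0 uv1 uv2 h1 h2.
have e2 : eta ^ 2 <= eta / 2 by nra.
have dN : eta * N <= d * N by nra.
have eN : eta ^ 2 * N <= eta * N / 2 by nra.
have dN2 : d * N <= N - eta * N by nra.
have eN0 : 0 <= eta * N by nra.
have e2N0 : 0 <= eta ^ 2 * N by apply: Rmult_le_pos; [exact: pow2_ge_0 | lra].
have uN : u * N <= d * N * N + 4 * N - (X + E).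
  have : u * N <= u * (u + v + 3) by apply: Rmult_le_compat_l.
  by lra.
have uN4 : u <= d * N + 4 by apply: (Rmult_le_reg_r N); lra.
case: (Rle_lt_dec u 0) => u0'; first by lra.
case: (Rle_lt_dec v (2 * u)) => uv.
  have hY : v * v <= 4 * (X + E) + 2 * v.
    have h3 : u * (v * v) <= u * (4 * (X + E) + 2 * v).
      have : v * X <= 2 * u * X by nra.
      by lra.
    by apply: Rmult_le_reg_l h3.
  have v7 : eta * N <= v + 7 by lra.
  have v7' : (eta * N) * (eta * N) <= (v + 7) * (v + 7) by apply: Rmult_le_compat; lra.
  have h4 : u * N <= (d * N + 9 - eta ^ 2 * N / 4) * N by lra.
  have h5 : u <= d * N + 9 - eta ^ 2 * N / 4.
    by apply: (Rmult_le_reg_r N) => //; lra.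
  by lra.
have hY : u * v <= 2 * (X + E) + 2 * u.
  have h3 : v * (u * v) <= v * (2 * (X + E) + 2 * u).
    have : 2 * u * E <= v * E by nra.
    by lra.
  by apply: Rmult_le_reg_l h3; lra.
have h4 : u * N <= (3 / 4 * (d * N) + 9) * N.
  have : u * (2 * (N - 3) / 3) <= u * v by apply: Rmult_le_compat_l; lra.
  by lra.
have h5 : u <= 3 / 4 * (d * N) + 9.
  by apply: (Rmult_le_reg_r N) => //; lra.
by lra.
Qed.

End RealBounds.

Section OutputBound.
Local Open Scope R_scope.

Lemma output_bound n (w : {set 'I_n} -> nat) (P m : mem_t) (eta d : R) :
  zero_one w -> (24 <= n)%N -> goodP n P -> locally_optimal (enc_weight w) n P ->
  (forall i, (i < n)%N -> m i = P (zig n i)) ->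
  0 < eta -> eta < 1 / 2 -> eta <= d -> d <= 1 - eta ->
  INR (wt w (Kn_edges n)) = d * INR 'C(n, 2) ->
  INR (wt w (output_cycle n m)) <= d * INR n - 2 / 25 * eta ^ 2 * INR n + 17.
Proof.
move=> zo n24 gP opt mE e0 e1 d1 d2 hd.
have n2 : (2 < n)%N by lia.
have [u [v [X [E [r [/andP[uv1 uv2] h1 h2 h3 h4]]]]]] := search_weight zo n2 gP opt mE.
have N24 := INR_leq n24; rewrite (INR_IZR_INZ 24) /= in N24.
have D : 2 * INR (wt w (Kn_edges n)) = d * (INR n * (INR n - 1)).
  rewrite hd; have := double_bin2 n => /(congr1 INR); rewrite !INR_muln.
  have -> : INR n.-1 = INR n - 1.
    by rewrite -[in RHS](@prednK n) ?S_INR; [lra | lia].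
  by rewrite /= => <-; lra.
have {}h3 : (n * r <= 2 * wt w (Kn_edges n) + 13 * n + 2 * r)%N.
  by move: h3; rewrite mulnBl; lia.
move: (INR_leq uv1) (INR_leq uv2) (INR_leq h1) (INR_leq h2) (INR_leq h3) (INR_leq h4).
rewrite !(INR_addn, INR_muln) (_ : INR 2 = 2) // D => r1 r2 r3 r4 r5 r6.
have [u0 v0 X0 E0] : [/\ 0 <= INR u, 0 <= INR v, 0 <= INR X & 0 <= INR E] by split; apply: pos_INR.
rewrite !(INR_IZR_INZ 3) !(INR_IZR_INZ 4) !(INR_IZR_INZ 13) /= in r2 r4 r5 r6.
have := @defect_real eta d (INR n) (INR u) (INR v) (INR X) (INR E) e0 e1 d1 d2 N24 u0 v0 X0 E0 r1 r2 r3 r4.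
have : INR r <= d * INR n + 20.
  have : INR n * INR r - 2 * INR r <= d * INR n * INR n + 13 * INR n by nra.
  by nra.
lra.
Qed.

End OutputBound.

(** * Concentration of the weight of a random Hamilton cycle *)

Lemma RplusA : associative Rplus. Proof. by move=> x y z; rewrite Rplus_assoc. Qed.
Lemma RplusC : commutative Rplus. Proof. exact: Rplus_comm. Qed.
Lemma Rplus0l : left_id (IZR 0) Rplus. Proof. exact: Rplus_0_l. Qed.
HB.instance Definition _ := Monoid.isComLaw.Build R (IZR 0) Rplus RplusA RplusC Rplus0l.

Notation "\rsum_ ( i 'in' A ) F" := (\big[Rplus/IZR 0]_(i in A) F)
  (at level 41, F at level 41, i, A at level 50).

Section Concentration.
Local Open Scope R_scope.

Section Rsum.
Variables (I : finType) (A : {set I}).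
Implicit Types F G : I -> R.

Lemma rsum_le F G : (forall i, i \in A -> F i <= G i) ->
  \rsum_(i in A) F i <= \rsum_(i in A) G i.
Proof.
move=> le; apply: (big_ind2 Rle) => //; first exact: Rle_refl.
by move=> *; apply: Rplus_le_compat.
Qed.

Lemma rsum_scale c F : \rsum_(i in A) (c * F i) = c * \rsum_(i in A) F i.
Proof.
by apply: (big_ind2 (fun x y => x = c * y)) => [|x1 x2 y1 y2 -> ->|//]; lra.
Qed.

Lemma rsum_const c : \rsum_(i in A) c = INR #|A| * c.
Proof.
rewrite big_const; elim: #|A| => [|k IH]; first by rewrite /=; lra.
by rewrite iterS S_INR IH; lra.
Qed.

Lemma rsum_INR (F : I -> nat) : \rsum_(i in A) INR (F i) = INR (\sum_(i in A) F i).
Proof. by apply/esym/(big_morph INR INR_addn). Qed.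

End Rsum.

(** Since [exp (- x) >= (1 - x/2)^2], it is enough that [(1 + x + x^2) (1 - x/2)^2 >= 1]. The excess
    is [x^2 (1/4 - 3x/4 + x^2/4)], and [x <= 1/3] keeps [1/4 - 3x/4] nonnegative. *)
Lemma exp_quadratic x : - (1 / 3) <= x -> x <= 1 / 3 -> exp x <= 1 + x + x * x.
Proof.
move=> x1 x2.
have h1 : 1 + - x / 2 <= exp (- x / 2) by apply: exp_ineq1_le.
have h2 : (1 - x / 2) * (1 - x / 2) <= exp (- x).
  have -> : exp (- x) = exp (- x / 2) * exp (- x / 2) by rewrite -exp_plus; congr exp; lra.
  by apply: Rmult_le_compat; lra.
have e0 := exp_pos x.
have h3 : exp x * exp (- x) = 1 by rewrite -exp_plus Rplus_opp_r exp_0.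
have h4 : exp x * ((1 - x / 2) * (1 - x / 2)) <= 1.
  by have := Rmult_le_compat_l _ _ _ (Rlt_le _ _ e0) h2; lra.
have h5 : 1 <= (1 + x + x * x) * ((1 - x / 2) * (1 - x / 2)).
  have -> : (1 + x + x * x) * ((1 - x / 2) * (1 - x / 2))
    = 1 + x * x * (1 / 4 - 3 / 4 * x + x * x / 4) by field.
  by have : 0 <= x * x * (1 / 4 - 3 / 4 * x + x * x / 4); [apply: Rmult_le_pos; nra | lra].
apply: (Rmult_le_reg_r ((1 - x / 2) * (1 - x / 2))); first by apply: Rmult_lt_0_compat; lra.
by lra.
Qed.

Section Martingale.
Variable n : nat.
Implicit Types (F : {perm 'I_n} -> R) (p q : {perm 'I_n}).

(** A copy of the symmetric group on the first [k] points. This chain of subgroups plays the role of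
    the filtration: [fixing k.+1] is the disjoint union of the translates of [fixing k] by
    [tperm k j], one for each value [j] of [p k]. *)
Definition fixing (k : nat) : {set {perm 'I_n}} :=
  [set p : {perm 'I_n} | [forall i : 'I_n, (k <= i)%N ==> (p i == i)]].

Definition lipschitz (c : R) F := forall p x y, F (p * tperm x y)%g <= F p + c.

Lemma fixingP k p : reflect (forall i : 'I_n, (k <= i)%N -> p i = i) (p \in fixing k).
Proof.
rewrite inE; apply: (iffP forallP) => h i; first by move=> ki; apply/eqP; move: (h i); rewrite ki.
by apply/implyP => /h ->.
Qed.

Lemma fixing_tperm k (i j : 'I_n) p : (i < k)%N -> (j < k)%N ->
  ((p * tperm i j)%g \in fixing k) = (p \in fixing k).
Proof.
move=> ik jk.
have h q : q \in fixing k -> (q * tperm i j)%g \in fixing k.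
  move=> /fixingP hq; apply/fixingP => l kl; rewrite permM hq // tpermD //.
    by apply/eqP => e; move: kl; rewrite -e; lia.
  by apply/eqP => e; move: kl; rewrite -e; lia.
by apply/idP/idP => [/h|/h //]; rewrite -mulgA tperm2 mulg1.
Qed.

Definition piece (k j : 'I_n) : {set {perm 'I_n}} := [set p : {perm 'I_n} in fixing k.+1 | p k == j].

Lemma piece_fixing (k j : 'I_n) p : (j <= k)%N ->
  ((p * tperm k j)%g \in piece k j) = (p \in fixing k).
Proof.
move=> jk; rewrite inE fixing_tperm //.
rewrite permM; apply/andP/fixingP => [[/fixingP h /eqP e] i|h]; last first.
  by rewrite h // tpermL; split=> //; apply/fixingP => i hi; apply: h; lia.
have ek : p k = k by apply: (@perm_inj _ (tperm k j)); rewrite e tpermL.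
rewrite leq_eqVlt => /orP[/eqP ki|]; last exact: h.
by have -> : i = k by apply/val_inj/esym.
Qed.

Lemma piece_swap (k i j : 'I_n) p : (i <= k)%N -> (j <= k)%N ->
  ((p * tperm i j)%g \in piece k j) = (p \in piece k i).
Proof.
move=> ik jk; rewrite /piece ![_ \in [set _ in _ | _]]inE fixing_tperm //.
congr andb; rewrite permM; apply/eqP/eqP => [e|->]; last by rewrite tpermL.
by apply: (@perm_inj _ (tperm i j)); rewrite e tpermL.
Qed.

Lemma rsum_piece (k j : 'I_n) F : (j <= k)%N ->
  \rsum_(q in piece k j) F q = \rsum_(p in fixing k) F (p * tperm k j)%g.
Proof.
move=> jk; rewrite (reindex_inj (mulIg (tperm k j))) /=.
by apply: eq_bigl => p; rewrite piece_fixing.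
Qed.

Lemma rsum_fixingS (k : 'I_n) F :
  \rsum_(q in fixing k.+1) F q =
  \rsum_(j in [set j : 'I_n | (j <= k)%N]) \rsum_(q in piece k j) F q.
Proof.
rewrite (partition_big (fun q : {perm 'I_n} => q k) (fun j => j \in [set j : 'I_n | (j <= k)%N])) /=.
  by apply: eq_bigr => j _; apply: eq_bigl => q; rewrite !inE.
move=> q /fixingP hq; rewrite inE leqNgt; apply/negP => lt.
by have := hq (q k) lt => /perm_inj e; rewrite e ltnn in lt.
Qed.

(** Conjugates of transpositions are transpositions. This lets the induction hypothesis on
    [fixing k] apply to [F] restricted to a translate. *)
Lemma lip_shift c F t : lipschitz c F -> lipschitz c (fun p => F (p * t)%g).
Proof.
move=> h p x y; have -> : (p * tperm x y * t = p * t * tperm (t x) (t y))%g.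
  by rewrite -tpermJ conjgE !mulgA mulgK.
exact: h.
Qed.

Lemma fixing_gt0 k : 0 < INR #|fixing k|.
Proof.
apply: (lt_INR 0); apply/ltP/card_gt0P; exists 1%g.
by apply/fixingP => i _; rewrite perm1.
Qed.

(* The exposure martingale: revealing p k moves the conditional mean by at most c,
   because tperm i j maps the permutations with p k = i onto those with p k = j. *)
Lemma mgf_bound c l k F : (k <= n)%N -> lipschitz c F -> Rabs l * c <= 1 / 3 -> 0 <= c ->
  \rsum_(p in fixing k) exp (l * (F p - (\rsum_(q in fixing k) F q) / INR #|fixing k|))
  <= INR #|fixing k| * exp (l * l * (c * c) * INR k).
Proof.
move=> kn lF lc c0; elim: k kn F lF => [|k IH] kn F lF.
  have f0 : fixing 0 = [set 1%g].
    apply/setP => p; rewrite in_set1; apply/fixingP/eqP => [h|-> i _]; last by rewrite perm1.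
    by apply/permP => i; rewrite h // perm1.
  rewrite f0 !big_set1 cards1 /= Rmult_0_r exp_0.
  have -> : l * (F 1%g - F 1%g / 1) = 0 by field.
  by rewrite exp_0; lra.
pose K := Ordinal kn; pose J := [set j : 'I_n | (j <= k)%N].
have SK G : \rsum_(q in fixing k.+1) G q = \rsum_(j in J) \rsum_(q in piece K j) G q.
  exact: (@rsum_fixingS K).
pose g := INR #|fixing k|; have g0 : 0 < g := fixing_gt0 k.
pose a j := (\rsum_(q in piece K j) F q) / g.
have cardP (j : 'I_n) : j \in J -> INR #|piece K j| = g.
  rewrite inE => jk; have := @rsum_piece K j (fun=> 1) jk.
  by rewrite !rsum_const -/g; lra.
pose NJ := INR #|J|.
have constJ x : \rsum_(j in J) x = NJ * x by apply: rsum_const.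
have cardS : INR #|fixing k.+1| = NJ * g.
  have := SK (fun=> 1); rewrite rsum_const Rmult_1_r => ->.
  rewrite -constJ; apply: eq_bigr => j jJ.
  by rewrite rsum_const cardP //; lra.
have J0 : 0 < NJ.
  by have := fixing_gt0 k.+1; rewrite cardS; nra.
set A := (\rsum_(q in fixing k.+1) F q) / INR #|fixing k.+1|.
have EA : NJ * A = \rsum_(j in J) a j.
  rewrite /A cardS SK /a /Rdiv.
  under [RHS]eq_bigr => j _ do rewrite Rmult_comm.
  by rewrite rsum_scale; field; lra.
have a_le (i j : 'I_n) : i \in J -> j \in J -> a j - a i <= c.
  move=> iJ jJ; move: (iJ) (jJ); rewrite !inE => ik jk; rewrite /a.
  have -> : \rsum_(q in piece K j) F q = \rsum_(q in piece K i) F (q * tperm i j)%g.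
    rewrite (reindex_inj (mulIg (tperm i j))) /=.
    by apply: eq_bigl => p; rewrite piece_swap.
  have : \rsum_(q in piece K i) F (q * tperm i j)%g <= \rsum_(q in piece K i) (F q + c).
    by apply: rsum_le => q _; apply: lF.
  rewrite big_split /= rsum_const cardP // => h.
  rewrite -Rdiv_minus_distr; apply: (Rmult_le_reg_r g) => //.
  by rewrite /Rdiv Rmult_assoc Rinv_l; lra.
have dev (j : 'I_n) : j \in J -> Rabs (a j - A) <= c.
  move=> jJ; apply: Rabs_le.
  have h1 : \rsum_(i in J) (a j - c) <= \rsum_(i in J) a i.
    by apply: rsum_le => i iJ; have := a_le i j iJ jJ; lra.
  have h2 : \rsum_(i in J) a i <= \rsum_(i in J) (a j + c).
    by apply: rsum_le => i iJ; have := a_le j i jJ iJ; lra.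
  move: h1 h2; rewrite -EA !constJ => h1 h2.
  have h3 := Rmult_le_reg_l _ _ _ J0 h1; have h4 := Rmult_le_reg_l _ _ _ J0 h2.
  by lra.
rewrite SK cardS.
have step (j : 'I_n) : j \in J -> \rsum_(q in piece K j) exp (l * (F q - A)) <=
    exp (l * (a j - A)) * (g * exp (l * l * (c * c) * INR k)).
  move=> jJ; move: (jJ); rewrite inE => jk; rewrite rsum_piece //.
  have := IH (ltnW kn) _ (lip_shift (tperm K j) lF).
  rewrite -[\rsum_(q in _) F (q * _)%g](@rsum_piece K j F jk) -/g -/(a j) => h.
  have -> : \rsum_(p in fixing K) exp (l * (F (p * tperm K j)%g - A)) =
     exp (l * (a j - A)) * \rsum_(p in fixing k) exp (l * (F (p * tperm K j)%g - a j)).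
    by rewrite -rsum_scale; apply: eq_bigr => p _; rewrite -exp_plus; congr exp; lra.
  by apply: Rmult_le_compat_l => //; apply/Rlt_le/exp_pos.
apply: Rle_trans (rsum_le step) _.
under eq_bigr => j _ do rewrite Rmult_comm.
rewrite rsum_scale.
(* By [EA] the number [A] is the plain mean of the [a j], so the linear terms of [exp_quadratic]
   cancel and only the quadratic one survives. *)
have sq : \rsum_(j in J) exp (l * (a j - A)) <= NJ * exp (l * l * (c * c)).
  have le (j : 'I_n) : j \in J -> exp (l * (a j - A)) <= (1 + l * l * (c * c) - l * A) + l * a j.
    move=> jJ; have hj := dev j jJ.
    have hx : Rabs (l * (a j - A)) <= Rabs l * c.
      by rewrite Rabs_mult; apply: Rmult_le_compat_l => //; apply: Rabs_pos.
    have x1 := Rle_abs (l * (a j - A)); have x2 := Rle_abs (- (l * (a j - A))).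
    rewrite Rabs_Ropp in x2.
    have xx : (l * (a j - A)) * (l * (a j - A)) <= l * l * (c * c).
      have -> : l * l * (c * c) = (Rabs l * c) * (Rabs l * c).
        by have := Rsqr_abs l; rewrite /Rsqr; nra.
      have -> : (l * (a j - A)) * (l * (a j - A)) = Rabs (l * (a j - A)) * Rabs (l * (a j - A)).
        exact: Rsqr_abs.
      by apply: Rmult_le_compat => //; apply: Rabs_pos.
    have := @exp_quadratic (l * (a j - A)); lra.
  apply: Rle_trans (rsum_le le) _.
  rewrite big_split /= constJ rsum_scale -EA.
  have := Rmult_le_compat_l _ _ _ (Rlt_le _ _ J0) (exp_ineq1_le (l * l * (c * c))).
  by lra.
rewrite S_INR Rmult_plus_distr_l exp_plus Rmult_1_r.
set e := exp _ in sq *; set e' := exp (_ * INR k).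
have -> : NJ * g * (e' * e) = g * e' * (NJ * e) by ring.
apply: Rmult_le_compat_l sq; apply: Rmult_le_pos; first lra.
exact/Rlt_le/exp_pos.
Qed.

End Martingale.
End Concentration.

(** * Lower tail of a Lipschitz function of a random permutation *)

Section Tail.
Local Open Scope R_scope.

Lemma fixing_all n : fixing n n = [set: {perm 'I_n}].
Proof. by apply/setP => p; rewrite in_setT; apply/fixingP => i; rewrite leqNgt ltn_ord. Qed.

Lemma perm_tail n (f : {perm 'I_n} -> nat) (A l : R) (x : nat) :
  lipschitz 4 (fun p => INR (f p)) -> 0 <= l -> l <= 1 / 12 ->
  INR (\sum_p f p) = INR #|[set: {perm 'I_n}]| * A ->
  INR #|[set p | (f p < x)%N]| <=
  INR #|[set: {perm 'I_n}]| * exp (l * (INR x - A) + 16 * (l * l) * INR n).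
Proof.
move=> lf l0 l1 hA.
have c0 : 0 < INR #|[set: {perm 'I_n}]| by rewrite -fixing_all; apply: fixing_gt0.
(* A lower tail calls for a negative parameter; [l <= 1 / 12] is the condition [4 * l <= 1 / 3]. *)
have := @mgf_bound n 4 (- l) n _ (leqnn n) lf.
rewrite fixing_all rsum_INR.
have -> : (\sum_(i in [set: {perm 'I_n}]) f i = \sum_p f p)%N.
  by apply: eq_bigl => p; rewrite in_setT.
rewrite hA; have -> : INR #|[set: {perm 'I_n}]| * A / INR #|[set: {perm 'I_n}]| = A.
  by field; lra.
rewrite Rabs_Ropp Rabs_right; last lra.
move=> h; have {}h := h ltac:(lra) ltac:(lra).
set N := INR #|[set: {perm 'I_n}]| in h *.
have -> : N * exp (l * (INR x - A) + 16 * (l * l) * INR n)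
   = exp (l * (INR x - A)) * (N * exp (- l * - l * (4 * 4) * INR n)).
  have -> : - l * - l * (4 * 4) * INR n = 16 * (l * l) * INR n by ring.
  by rewrite exp_plus; ring.
apply: Rle_trans (Rmult_le_compat_l _ _ _ (Rlt_le _ _ (exp_pos _)) h).
rewrite -rsum_scale.
have -> : INR #|[set p | (f p < x)%N]| =
    \rsum_(p in [set: {perm 'I_n}]) INR (nat_of_bool (f p < x)%N).
  rewrite rsum_INR -sum1_card; congr INR; rewrite -big_mkcondr /=.
  by apply: eq_bigl => p; rewrite !inE.
apply: rsum_le => p _; rewrite -exp_plus.
case: ltnP => hx /=; last exact/Rlt_le/exp_pos.
have hx' : INR (f p) <= INR x by apply: INR_leq; apply: ltnW.
apply: Rle_trans (exp_ineq1_le _).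
have : 0 <= l * (INR x - INR (f p)) by apply: Rmult_le_pos; lra.
lra.
Qed.

End Tail.

(** * Mean weight, and passing from permutations to Hamilton cycles *)

Section Cycles.
Variables (n : nat) (w : {set 'I_n} -> nat).
Local Notation W := (enc_weight w).

Definition cyc_weight (p : {perm 'I_n}) : nat := \sum_(i < n) W (p i) (p (ordS i)).

Lemma ordS_neq (i : 'I_n) : 1 < n -> ordS i != i.
Proof.
move=> n1; apply/eqP => /(congr1 val) /=; have := ltn_ord i.
have [h|h] := ltnP i.+1 n; first by rewrite modn_small //; lia.
by move=> hi; have -> : i.+1 = n by [lia]; rewrite modnn; lia.
Qed.

Lemma ordS2_neq (i : 'I_n) : 2 < n -> ordS (ordS i) != i.
Proof.
move=> n2; apply/eqP => /(congr1 val) /=; have := ltn_ord i.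
have [h|h] := ltnP i.+1 n; last first.
  by move=> hi; have -> : i.+1 = n by [lia]; rewrite modnn modn_small; lia.
rewrite (modn_small h); have [h'|h'] := ltnP i.+2 n; first by rewrite modn_small //; lia.
by move=> hi; have -> : i.+2 = n by [lia]; rewrite modnn; lia.
Qed.

Lemma wt_cyc_edges p : 2 < n -> wt w (cyc_edges p) = cyc_weight p.
Proof.
move=> n2; rewrite /wt /cyc_edges big_imset /=; last first.
  move=> i j _ _ /= e.
  have := set21 (p i) (p (ordS i)); have := set22 (p i) (p (ordS i)).
  rewrite e !inE !(inj_eq perm_inj) => /orP[]/eqP h2 /orP[]/eqP h1 //.
    by have := ordS2_neq j n2; rewrite -h1 h2 eqxx.
  exact/ordS_inj.
apply: eq_bigr => i _; rewrite enc_ord ifN // (inj_eq perm_inj) eq_sym.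
by apply: ordS_neq; lia.
Qed.

Lemma sum_inj_delta (h : 'I_n -> 'I_n) x : injective h -> \sum_(i < n) (h i == x : nat) <= 1.
Proof.
move=> hi; rewrite -big_mkcond /= sum1_card; apply/card_le1_eqP => i j.
by rewrite !unfold_in => /eqP e1 /eqP e2; apply: hi; apply: val_inj; rewrite e1 e2.
Qed.

Lemma lip_cyc_weight : zero_one w -> lipschitz (IZR 4) (fun p => INR (cyc_weight p)).
Proof.
move=> zo p x y; have -> : IZR 4 = INR 4 by rewrite (INR_IZR_INZ 4).
rewrite -INR_addn; apply: INR_leq.
pose D i := (p i == x) + (p i == y) + (p (ordS i) == x) + (p (ordS i) == y).
have le : \sum_(i < n) D i <= 4.
  have h1 z : \sum_(i < n) (p i == z : nat) <= 1 by apply: sum_inj_delta perm_inj.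
  have h2 z : \sum_(i < n) (p (ordS i) == z : nat) <= 1.
    by apply: (@sum_inj_delta (fun i => p (ordS i))) => i j /perm_inj/ordS_inj.
  by rewrite !big_split /= -[4]/(1 + 1 + 1 + 1) !leq_add.
apply: (@leq_trans (cyc_weight p + \sum_(i < n) D i)); last by rewrite leq_add2l.
rewrite -big_split /=; apply: leq_sum => i _; rewrite !permM.
case: (posnP (D i)) => [/eqP|D0]; last first.
  by apply: leq_trans (enc_le1 zo _ _) _; apply: leq_trans D0 (leq_addl _ _).
rewrite !addn_eq0 !eqb0 -!andbA => /and4P[d1 d2 d3 d4].
by rewrite !tpermD ?leq_addr // eq_sym.
Qed.

(** Double transitivity: [s] sends [x] to [x'] and then corrects the image [z] of [y] to [y']
    without moving [x']. Translating by [s] permutes the summands. *)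
Lemma sum_perm_pair (x y x' y' : 'I_n) : x != y -> x' != y' ->
  \sum_(p : {perm 'I_n}) W (p x') (p y') = \sum_(p : {perm 'I_n}) W (p x) (p y).
Proof.
move=> xy xy'; pose z := tperm x x' y; pose s := (tperm x x' * tperm z y')%g.
have zx : z != x' by rewrite -[x'](tpermL x x') (inj_eq perm_inj) eq_sym.
have sx : s x = x' by rewrite permM tpermL tpermD // eq_sym.
have sy : s y = y' by rewrite permM -/z tpermL.
clearbody s.
rewrite [RHS](reindex_inj (mulgI s)) /=; apply: eq_bigr => p _.
by rewrite !permM sx sy.
Qed.

(** The sum over permutations is the same [T] for each of the [n] edge slots and for each of the
    [n * n.-1] ordered pairs of distinct positions; the latter together count every edge of the
    graph twice per permutation. *)
Lemma sum_cyc_weight : 2 < n ->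
  n.-1 * \sum_p cyc_weight p = #|[set: {perm 'I_n}]| * (2 * wt w (Kn_edges n)).
Proof.
move=> n2; have n0 : 0 < n by lia.
pose o := Ordinal n0; pose T := \sum_(p : {perm 'I_n}) W (p o) (p (ordS o)).
have oS : o != ordS o by rewrite eq_sym; apply: ordS_neq; lia.
have -> : \sum_p cyc_weight p = n * T.
  rewrite exchange_big /= -[n in RHS]card_ord -sum_nat_const; apply: eq_bigr => i _.
  by apply: sum_perm_pair => //; rewrite eq_sym; apply: ordS_neq; lia.
have e1 : \sum_(x : 'I_n) \sum_(y : 'I_n) \sum_(p : {perm 'I_n}) W (p x) (p y) = n * (n.-1 * T).
  rewrite -[n in n * _]card_ord -sum_nat_const; apply: eq_bigr => x _.
  rewrite (bigD1 x) //= big1 ?add0n; last by move=> p _; apply: enc_diag.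
  have -> : n.-1 = #|[pred y : 'I_n | y != x]|.
    by have := cardC1 x; rewrite card_ord => <-; apply: eq_card.
  rewrite -sum_nat_const; apply: eq_bigr => y yx.
  by apply: sum_perm_pair => //; rewrite eq_sym.
have e2 : \sum_(x : 'I_n) \sum_(y : 'I_n) \sum_(p : {perm 'I_n}) W (p x) (p y) =
   #|[set: {perm 'I_n}]| * (2 * wt w (Kn_edges n)).
  under eq_bigr => x _ do rewrite exchange_big /=.
  rewrite exchange_big /= -sum_nat_const; apply: eq_big => p; first by rewrite in_setT.
  move=> _; rewrite -sum_ord_pairs [RHS](reindex_inj (@perm_inj _ p)) /=; apply: eq_bigr => x _.
  by rewrite [RHS](reindex_inj (@perm_inj _ p)).
by rewrite -e2 e1; lia.
Qed.

Lemma cyc_edgesM (p s : {perm 'I_n}) :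
  cyc_edges (p * s)%g = [set s @: (e : {set 'I_n}) | e in cyc_edges p].
Proof.
rewrite /cyc_edges -imset_comp; apply: eq_imset => i /=.
by rewrite imsetU1 imset_set1 !permM.
Qed.

Definition fiber_size : nat := #|[set q : {perm 'I_n} | cyc_edges q == cyc_edges 1]|.

(** Right multiplication by [p] relabels vertices and carries the fibre over the standard cycle to
    the fibre over [cyc_edges p]. Hence a uniform permutation induces a uniform Hamilton cycle. *)
Lemma card_fiber p : #|[set q : {perm 'I_n} | cyc_edges q == cyc_edges p]| = fiber_size.
Proof.
rewrite /fiber_size -!sum1_card [LHS](reindex_inj (mulIg p)) /=.
apply: eq_bigl => q; rewrite !inE -[in X in _ == X](mul1g p) !cyc_edgesM.
have inj : injective (fun E : {set {set 'I_n}} => [set p @: (e : {set 'I_n}) | e in E]).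
  by apply: imset_inj; apply: imset_inj; apply: perm_inj.
exact: (inj_eq inj).
Qed.

Lemma card_perm_cyc (Q : pred {set {set 'I_n}}) :
  #|[set p : {perm 'I_n} | Q (cyc_edges p)]| = #|[set H in ham_cycles n | Q H]| * fiber_size.
Proof.
rewrite -sum1_card (eq_bigl (fun p : {perm 'I_n} => Q (cyc_edges p))); last by move=> p; rewrite inE.
rewrite (partition_big (@cyc_edges n) (fun H => H \in [set H in ham_cycles n | Q H])) /=; last first.
  by move=> p Qp; rewrite inE Qp andbT; apply: imset_f.
rewrite -sum_nat_const; apply: eq_bigr => H; rewrite inE => /andP[/imsetP[p _ ->] Qp].
rewrite -(card_fiber p) -sum1_card; apply: eq_bigl => q; rewrite inE.
by case: eqP => [->|_]; rewrite ?Qp ?andbF.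
Qed.

End Cycles.

Lemma ham_cycles_gt0 n : 0 < #|ham_cycles n|.
Proof. by apply/card_gt0P; exists (cyc_edges 1); apply: imset_f. Qed.

Lemma Phi_id_le n (w : {set 'I_n} -> nat) : 2 < n -> zero_one w ->
  Phi (enc_weight w) n id < 8 * n.
Proof.
move=> n2 zo; apply: (@leq_ltn_trans (\sum_(1 <= x < n) 6)).
  by apply: leq_sum => x _; rewrite /term; have W1 := enc_le1 zo;
    have := W1 x (n - x); have := W1 x (n.-1 - x); lia.
by rewrite sum_nat_const_nat; lia.
Qed.

(** * Tail bounds for Hamilton cycles and the domination ratio *)

Section Domination.
Local Open Scope R_scope.

Lemma bad_ratio_le1 n (w : {set 'I_n} -> nat) x :
  INR #|[set H in ham_cycles n | (wt w H < x)%N]| / INR #|ham_cycles n| <= 1.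
Proof.
have h0 : 0 < INR #|ham_cycles n| by apply: (lt_INR 0); apply/ltP/ham_cycles_gt0.
apply: (Rmult_le_reg_r (INR #|ham_cycles n|)) => //.
rewrite /Rdiv Rmult_assoc Rinv_l ?Rmult_1_r ?Rmult_1_l; last lra.
by apply: INR_leq; apply: subset_leq_card; apply/subsetP => H; rewrite inE => /andP[].
Qed.

Lemma bad_ratio_tail n (w : {set 'I_n} -> nat) (d l : R) x :
  zero_one w -> (2 < n)%N -> INR (wt w (Kn_edges n)) = d * INR 'C(n, 2) ->
  0 <= l -> l <= 1 / 12 ->
  INR #|[set H in ham_cycles n | (wt w H < x)%N]| / INR #|ham_cycles n| <=
  exp (l * (INR x - d * INR n) + 16 * (l * l) * INR n).
Proof.
move=> zo n2 hd l0 l1.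
set N := #|[set: {perm 'I_n}]|.
have N0 : 0 < INR N by rewrite /N -fixing_all; apply: fixing_gt0.
have nE : INR n.-1 = INR n - 1 by rewrite -[in RHS](@prednK n) ?S_INR; [lra | lia].
have n3 : 3 <= INR n by have := INR_leq n2; rewrite (INR_IZR_INZ 3).
have mean : INR (\sum_p cyc_weight w p) = INR N * (d * INR n).
  have := sum_cyc_weight w n2 => /(congr1 INR); rewrite !INR_muln -/N hd => h.
  have := double_bin2 n => /(congr1 INR); rewrite !INR_muln nE => hb.
  have h2 : INR 2 * (d * INR 'C(n, 2)) = d * (INR n * (INR n - 1)) by rewrite -hb; ring.
  rewrite h2 nE in h; apply: (Rmult_eq_reg_l (INR n - 1)); last lra.
  by rewrite h; ring.
have := perm_tail x (lip_cyc_weight zo) l0 l1 mean; rewrite -/N.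
have -> : #|[set p | (cyc_weight w p < x)%N]| =
    (#|[set H in ham_cycles n | (wt w H < x)%N]| * fiber_size n)%N.
  rewrite -(card_perm_cyc (fun H => (wt w H < x)%N)); apply: eq_card => p.
  by rewrite !inE wt_cyc_edges.
have EN : INR N = INR #|ham_cycles n| * INR (fiber_size n).
  have := @card_perm_cyc n xpredT; rewrite -INR_muln.
  have -> : [set p : {perm 'I_n} | xpredT (cyc_edges p)] = [set: {perm 'I_n}].
    by apply/setP => p; rewrite !inE.
  have -> : [set H in ham_cycles n | xpredT H] = ham_cycles n.
    by apply/setP => H; rewrite !inE andbT.
  by move=> <-.
have h0 : 0 < INR #|ham_cycles n| by apply: (lt_INR 0); apply/ltP/ham_cycles_gt0.
have f0 : 0 < INR (fiber_size n) by nra.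
rewrite EN INR_muln; set b := INR #|[set _ in _ | _]|; set e := exp _ => h.
apply: (Rmult_le_reg_r (INR #|ham_cycles n| * INR (fiber_size n))); first by nra.
have -> : b / INR #|ham_cycles n| * (INR #|ham_cycles n| * INR (fiber_size n)) = b * INR (fiber_size n).
  by field; lra.
lra.
Qed.

End Domination.

Theorem theorem1p2 (eta : R) (Heta : Rlt 0 eta /\ Rlt eta (Rdiv 1 2)) :
  exists (prog : seq instr) (Ct : nat) (C : R),
    forall (n : nat) (w : {set 'I_n} -> nat),
      3 <= n ->
      exists m : nat -> nat,
        exec prog (Ct * n ^ 5) (init_state w) = Some m /\
        valid_output n m /\
        (zero_one w ->
         (exists d : R, Rle eta d /\ Rle d (Rminus 1 eta) /\
            INR (wt w (Kn_edges n)) = Rmult d (INR 'C(n, 2))) ->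
         dom_ratio_at_least w (output_cycle n m)
           (Rminus 1 (Rmult C (exp (Ropp (Rdiv (Rmult (pow eta 4) (INR n)) 10000)))))).
Proof.
case: Heta => e0 e1.
(* [exp 1] absorbs two errors: for [n < 24] it lifts the bound above 1, and for larger [n] it covers
   the additive constant 17 of [output_bound], since [17 * eta^2 / 400 <= 1]. *)
exists (tsp_code 0), 700, (exp 1) => n w n3.
have [m [run [small large]]] := tsp_codeP w n3.
exists m; split=> //.
have e2 : Rle 0 (eta ^ 2) by exact: pow2_ge_0.
have e2' : Rle (eta ^ 2) (1 / 4) by nra.
have e4 : Rle (eta ^ 4) (1 / 16).
  have -> : pow eta 4 = Rmult (eta ^ 2) (eta ^ 2) by ring.
  by nra.
have [lt24|le24] := ltnP n 24.
  have mE := small lt24; split.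
    by apply: perm_eq_inj_iota => [i hi|i j hi hj]; rewrite !mE.
  move=> zo _; rewrite /dom_ratio_at_least -exp_plus.
  apply: Rle_trans (bad_ratio_le1 _ _) _.
  have N24 := INR_leq (ltnW lt24); rewrite (INR_IZR_INZ 24) /= in N24.
  have N0 := pos_INR n.
  have := exp_ineq1_le (1 + - (eta ^ 4 * INR n / 10000)).
  nra.
pose P := iter (8 * n) (pass (enc_weight w) n) id.
have gP : goodP n P.
  by rewrite /P; elim: (8 * n) => [|k IH]; [apply: goodP_id | apply: goodP_pass].
have mE := large le24; have [P0 Pn Pi] := gP; split.
  apply: perm_eq_inj_iota => [i hi|i j hi hj].
    by rewrite mE //; apply/Pn/zig_lt.
  rewrite !mE // => /Pi; rewrite !zig_lt // => /(_ isT isT); exact: zig_inj.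
move=> zo [d [d1 [d2 hd]]].
have opt : locally_optimal (enc_weight w) n P by apply/iter_pass_optimal/Phi_id_le.
have bound := output_bound zo le24 gP opt mE e0 e1 d1 d2 hd.
rewrite /dom_ratio_at_least -exp_plus.
(* This [l] minimises [16 l^2 - (2/25) eta^2 l], and the minimum is exactly [- eta^4 / 10^4]. *)
have l0 : Rle 0 (eta ^ 2 / 400) by lra.
have l1 : Rle (eta ^ 2 / 400) (1 / 12) by lra.
apply: Rle_trans (bad_ratio_tail _ zo n3 hd l0 l1) _.
set x := INR (wt _ _) in bound *; set N := INR n in bound *.
suff le : Rle (eta ^ 2 / 400 * (x - d * N) + 16 * (eta ^ 2 / 400 * (eta ^ 2 / 400)) * N)
     (1 + - (eta ^ 4 * N / 10000)).
  by case: le => [/exp_increasing|->]; lra.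
have h : Rle (eta ^ 2 / 400 * (x - d * N)) (eta ^ 2 / 400 * (17 - 2 / 25 * eta ^ 2 * N)).
  by apply: Rmult_le_compat_l; lra.
lra.
Qed.
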